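(* Let $\underline{C}=(C_1,\ldots,C_d)$ be a row contraction on a Hilbert space $\mathcal{H}_C$ and let $\underline{E}=(E_1,\ldots,E_d)$ be a minimal contractive lifting of $\underline{C}$ on $\mathcal{H}_E=\mathcal{H}_C\oplus\mathcal{H}_A$, where $$E_i=\begin{bmatrix} C_i & 0 \\ B_i & A_i \end{bmatrix}\quad(1\le i\le d).$$ Let $\gamma:\mathcal{D}_{*,A}\to\mathcal{D}_C$ be a contraction such that $\underline{B}^*=D_C\gamma D_{*,A}$. Then $$\theta_{C,E}=\begin{bmatrix}D_{*,\gamma}&(I_\Gamma\otimes\gamma)\theta_A\end{bmatrix}\sigma,$$ where $\sigma:\mathcal{D}_E\to\mathcal{D}_{*,\gamma}\oplus\mathcal{D}_A$ is a unitary operator defined by $$\sigma D_E=\begin{bmatrix} D_{*,\gamma}D_C & 0 \\ -\underline{A}^*\gamma^*D_C & D_A \end{bmatrix},$$ the matrix being taken with respect to the identification $\bigoplus_{i=1}^d\mathcal{H}_E=\bigl(\bigoplus_{i=1}^d\mathcal{H}_C\bigr)\oplus\bigl(\bigoplus_{i=1}^d\mathcal{H}_A\bigr)$ of the domain, and $D_{*,\gamma}x$ being regarded as $e_0\otimes D_{*,\gamma}x\in\Gamma\otimes\mathcal{D}_C$.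
   Context: A tuple $\underline{T}=(T_1,\ldots,T_d)$ of bounded operators on a Hilbert space $\mathcal{H}$ is a row contraction if $\sum_{i=1}^d T_iT_i^*\le I$; we view $\underline{T}=[T_1\ \cdots\ T_d]:\bigoplus_{i=1}^d\mathcal{H}\to\mathcal{H}$. Defect operators and spaces: $D_T=(I-\underline{T}^*\underline{T})^{1/2}$ on $\bigoplus_{i=1}^d\mathcal{H}$, $D_{*,T}=(I-\underline{T}\,\underline{T}^* )^{1/2}$ on $\mathcal{H}$, $\mathcal{D}_T=\overline{\mathrm{ran}}\,D_T$, $\mathcal{D}_{*,T}=\overline{\mathrm{ran}}\,D_{*,T}$. For a contraction $\gamma:\mathcal{D}_{*,A}\to\mathcal{D}_C$: $D_{*,\gamma}=(I-\gamma\gamma^* )^{1/2}$ on $\mathcal{D}_C$ and $\mathcal{D}_{*,\gamma}=\overline{\mathrm{ran}}\,D_{*,\gamma}$. $\tilde\Lambda$ is the set of all finite words $\alpha=(\alpha_1,\ldots,\alpha_n)$ in $\{1,\ldots,d\}$ (including the empty word), $|\alpha|=n$, $T_\alpha=T_{\alpha_1}\cdots T_{\alpha_n}$ ($T_\emptyset=I$). $\Gamma$ is the full Fock space over $\mathbb{C}^d$ with vacuum vector $e_0$; $e_\alpha=e_{\alpha_1}\otimes\cdots\otimes e_{\alpha_n}$ ($e_\emptyset=e_0$). $\iota_j^{\mathcal{H}}:\mathcal{H}\to\bigoplus_{i=1}^d\mathcal{H}$ is the inclusion as $j$-th component and $P_k$ the $k$-th coordinate projection $\bigoplus_{i=1}^d\mathcal{H}\to\mathcal{H}$.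 A row contraction $\underline{E}$ on $\mathcal{H}_E=\mathcal{H}_C\oplus\mathcal{H}_A$ is a contractive lifting of $\underline{C}$ (by $\underline{A}$) if each $E_i$ has the displayed lower triangular form; it is minimal if $\mathcal{H}_E=\overline{\mathrm{span}}\{E_\alpha x:x\in\mathcal{H}_C,\alpha\in\tilde\Lambda\}$. Write $\underline{B}=[B_1\ \cdots\ B_d]:\bigoplus_{i=1}^d\mathcal{H}_C\to\mathcal{H}_A$. It is known that for a contractive lifting, $\underline{A}$ is a row contraction and a (unique) contraction $\gamma:\mathcal{D}_{*,A}\to\mathcal{D}_C$ with $\underline{B}^*=D_C\gamma D_{*,A}$ exists. The characteristic function (symbol) of $\underline{A}$ is $\theta_A:\mathcal{D}_A\to\Gamma\otimes\mathcal{D}_{*,A}$, $\theta_Ax=-e_0\otimes\underline{A}x+\sum_{k=1}^d\sum_{\alpha}e_k\otimes e_\alpha\otimes D_{*,A}A_\alpha^*P_kD_Ax$. The characteristic function (symbol) of the lifting $\underline{E}$ of $\underline{C}$ is the operator $\theta_{C,E}:\mathcal{D}_E\to\Gamma\otimes\mathcal{D}_C$ determined, for $j=1,\dots,d$, $h_c\in\mathcal{H}_C$, $h_a\in\mathcal{H}_A$, by $$\theta_{C,E}D_E\iota_j^{\mathcal{H}_E}(h_c)=e_0\otimes\bigl(D_C\iota_j^{\mathcal{H}_C}(h_c)-\gamma D_{*,A}B_jh_c\bigr)-\sum_{|\alpha|\ge1}e_\alpha\otimes\gamma D_{*,A}A_\alpha^*B_jh_c,$$ $$\theta_{C,E}D_E\iota_j^{\mathcal{H}_E}(h_a)=-e_0\otimes\gamma\underline{A}D_A\iota_j^{\mathcal{H}_A}(h_a)+\sum_{k=1}^d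 e_k\otimes\sum_{\alpha}e_\alpha\otimes\gamma D_{*,A}A_\alpha^*P_kD_A^2\iota_j^{\mathcal{H}_A}(h_a).$$ *)

(* Defs.v *)
From HB Require Import structures.
From mathcomp Require Import all_boot all_order all_algebra sesquilinear.
From mathcomp Require Import finmap complex ring.
From mathcomp Require Import boolp classical_sets functions reals topology normedtype.
From mathcomp.analysis.showcase Require summability.
Set Implicit Arguments.
Unset Strict Implicit.
Unset Printing Implicit Defensive.
Import Order.TTheory GRing.Theory Num.Theory Num.Def.
Import numFieldNormedType.Exports.
Local Open Scope classical_set_scope.
Local Open Scope ring_scope.

Section InnerProduct.
Variables (C : numClosedFieldType) (V : lmodType C) (dot : {dot V for conjC}).

Lemma dotZl a x y : dot (a *: x) y = a * dot x y.
Proof. exact: linearZl_LR. Qed.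

Lemma dotZr a x y : dot x (a *: y) = a^* * dot x y.
Proof. by rewrite linearZr_LR. Qed.

Lemma dotC x y : dot x y = (dot y x)^*.
Proof. by rewrite hermC expr0 mul1r. Qed.

Lemma dot_CauchySchwarz x y :
  `|dot x y| <= sqrtC (dot x x) * sqrtC (dot y y).
Proof.
have [->|y0] := eqVneq y 0; first by rewrite !linear0r normr0 sqrtC0 mulr0.
rewrite -sqrtCM ?qualifE/= ?dnorm_ge0//.
rewrite -(@ler_sqr _ `|_|) ?qualifE/= ?normr_ge0 ?sqrtC_ge0 ?mulr_ge0 ?dnorm_ge0//.
rewrite sqrtCK.
have yy : 0 < dot y y by rewrite dnorm_gt0.
pose a := dot x y / dot y y.
have := dnorm_ge0 dot (x - a *: y).
rewrite dnormB dnormZ dotZr.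
have -> : a^* * dot x y = `|dot x y| ^+ 2 / dot y y.
  rewrite normCK /a rmorphM /= fmorphV [X in _ / X](_ : _ = dot y y).
    by rewrite mulrAC [X in X / _]mulrC.
  exact: esym (dotC y y).
have -> : (`|dot x y| ^+ 2 / dot y y)^* = `|dot x y| ^+ 2 / dot y y.
  by apply: geC0_conj; rewrite divr_ge0 ?exprn_ge0 ?dnorm_ge0.
have -> : `|a| ^+ 2 * dot y y = `|dot x y| ^+ 2 / dot y y.
  rewrite /a normf_div (ger0_norm (dnorm_ge0 dot y)) expr_div_n -mulrA.
  by congr (_ * _); rewrite expr2 invfM -mulrA mulVf ?mulr1 ?gt_eqF.
by rewrite opprD addrA addrK subr_ge0 ler_pdivrMr.
Qed.

Lemma dot_triangle x y :
  sqrtC (dot (x + y) (x + y)) <= sqrtC (dot x x) + sqrtC (dot y y).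
Proof.
rewrite -ler_sqr ?qualifE/= ?addr_ge0 ?sqrtC_ge0 ?dnorm_ge0//.
rewrite sqrrD !sqrtCK dnormD [leRHS]addrAC lerD2l.
have -> : dot x y + (dot x y)^* = 'Re (dot x y) *+ 2.
  by rewrite -mulr_natr ReE mulfVK ?pnatr_eq0.
rewrite lerMn2r /=.
apply: le_trans (dot_CauchySchwarz x y).
apply: le_trans (real_ler_norm (Creal_Re _)) _.
rewrite -(@ler_sqr _ `|_|) ?qualifE/= ?normr_ge0//.
rewrite (normC2_Re_Im (dot x y)) (real_normK (Creal_Re _)).
by rewrite lerDl real_exprn_even_ge0 ?Creal_Im.
Qed.

Lemma sqrtdotZ a x : sqrtC (dot (a *: x) (a *: x)) = `|a| * sqrtC (dot x x).
Proof. by rewrite dnormZ sqrtCM ?qualifE/= ?exprn_ge0 ?dnorm_ge0// sqrCK. Qed.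

Lemma sqrtdot_eq0 x : sqrtC (dot x x) = 0 -> x = 0.
Proof. by move/eqP; rewrite sqrt_dnorm_eq0 => /eqP. Qed.

End InnerProduct.

(* Complex Hilbert spaces: Banach spaces over R[i] whose norm comes from an
   inner product, linear in its first argument and antilinear in the second. *)
HB.mixin Record isHilbert (R : realType) V of CompleteNormedModule R[i] V := {
  hdot : {dot V for (@conjC R[i])};
  hdot_normE : forall x : V, hdot x x = `|x| ^+ 2
}.
#[short(type="hilbertType")]
HB.structure Definition Hilbert (R : realType) :=
  {V of isHilbert R V & CompleteNormedModule R[i] V}.

Definition dot_complete (C : numDomainType) (V : lmodType C) (dot : V -> V -> C) :=
  forall u : nat -> V,
    (forall e : C, 0 < e -> exists N, forall m n, (N <= m)%N -> (N <= n)%N ->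
       dot (u m - u n) (u m - u n) <= e) ->
    exists l, forall e : C, 0 < e -> exists N, forall n, (N <= n)%N ->
       dot (u n - l) (u n - l) <= e.

(* A complete inner product on a bare module determines norm and topology. *)
HB.factory Record Lmodule_isHilbert (R : realType) V of GRing.Lmodule R[i] V := {
  dot : {dot V for (@conjC R[i])};
  dot_cplt : dot_complete dot
}.
HB.builders Context R V of Lmodule_isHilbert R V.

HB.instance Definition _ := @Lmodule_isNormed.Build R[i] V
  (fun x => sqrtC (dot x x)) (dot_triangle dot) (sqrtdotZ dot) (@sqrtdot_eq0 _ _ dot).

Let dotE (x : V) : dot x x = `|x| ^+ 2.
Proof. by rewrite /Num.norm/= sqrtCK. Qed.

Let cplt (F : set_system V) : ProperFilter F -> cauchy F -> cvg F.
Proof.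
move=> PF /(@cauchyP R[i] V F PF) cF.
pose e_ (n : nat) : R[i] := n.+1%:R^-1.
have e0 n : 0 < e_ n by rewrite invr_gt0 ltr0n.
have [u uP] : {u : nat -> V & forall n, F (ball (u n) (e_ n))}.
  apply: (@choice _ _ (fun n x => F (ball x (e_ n)))) => n; exact: cF.
have arch (e : R[i]) : 0 < e -> exists N, e_ N < e.
  move=> epos; have [r rpos er] : exists2 r : R, 0 < r & e = r%:C%C.
    case: e epos => a b; rewrite ltcE /= => /andP[/eqP b0 a0].
    by exists a; rewrite // b0.
  exists (Num.truncn r^-1); rewrite er /e_ -(rmorph_nat (real_complex R)) -fmorphV ltcR.
  rewrite invf_plt ?qualifE/= ?ltr0n//.
  by case/andP: (truncn_itv (ltW (eq_ind _ is_true rpos _ (esym (invr_gt0 r))))) => //.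
have eD m n : `|u m - u n| <= e_ m + e_ n.
  have [x []] := filter_ex (filterI (uP m) (uP n)).
  rewrite -!ball_normE /= => h1 h2.
  rewrite -(subrK x (u m)) -addrA (le_trans (ler_normD _ _))// lerD// ltW//.
  by rewrite distrC.
have emono m n : (m <= n)%N -> e_ n <= e_ m.
  by move=> mn; rewrite lef_pV2 ?qualifE/= ?ltr0n// ler_nat.
have [l lP] : exists l, forall e : R[i], 0 < e -> exists N, forall n, (N <= n)%N ->
   `|u n - l| <= e.
  have /dot_cplt[l lP] : forall e : R[i], 0 < e -> exists N, forall m n, (N <= m)%N -> (N <= n)%N ->
       dot (u m - u n) (u m - u n) <= e.
    move=> e epos; have [|N hN] := arch (sqrtC e / 2).
      by rewrite divr_gt0 ?sqrtC_gt0.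
    exists N => m n Nm Nn; rewrite dotE.
    have se : 0 <= sqrtC e by rewrite sqrtC_ge0 ltW.
    rewrite -(sqrtCK e) ler_sqr ?qualifE//= ltW//.
    rewrite (le_lt_trans (eD _ _))// [ltRHS]splitr ltrD//.
      exact: le_lt_trans (emono _ _ Nm) _.
    exact: le_lt_trans (emono _ _ Nn) _.
  exists l => e epos; have [|N hN] := lP (e ^+ 2); first by rewrite exprn_gt0.
  exists N => n /hN; by rewrite dotE ler_sqr ?qualifE//= ltW.
apply: (@cvgP V F l); apply/cvg_ballP => e epos.
have e2 : 0 < e / 2 by rewrite divr_gt0.
have [N1 h1] := arch _ e2.
have [N2 h2] := lP _ e2.
pose N := maxn N1 N2.
apply: filterS (uP N) => x; rewrite -!ball_normE /= => hx.
rewrite -(subrK (u N) l) -addrA (le_lt_trans (ler_normD _ _))// [ltRHS]splitr ler_ltD//.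
  by rewrite distrC h2// leq_maxr.
by apply: lt_le_trans hx _; rewrite (le_trans (emono _ _ (leq_maxl N1 N2)))// ltW.
Qed.

HB.instance Definition _ := Uniform_isComplete.Build V cplt.
HB.instance Definition _ := isHilbert.Build R V dotE.
HB.end.
Notation totally := summability.totally.
Notation partial_sum := summability.partial_sum.
#[export] Existing Instance summability.totally_filter.

Section Series.
Variables (R : realType) (I : choiceType).
Implicit Types (a b c : I -> R[i]) (J K : {fset I}).

Lemma partial_sumE (V : zmodType) (x : I -> V) J :
  partial_sum x J = \sum_(i <- J) x i.
Proof. by rewrite /summability.partial_sum (big_seq_fsetE _ _ predT). Qed.

Lemma partial_sum_sub a J K : (forall i, 0 <= a i) -> fsubset J K ->
  partial_sum a J <= partial_sum a K.
Proof.
move=> a0 JK; rewrite !partial_sumE (big_fsetID _ (mem J) K)/=.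
have -> : [fset x in K | x \in J]%fset = J.
  apply/fsetP => i; rewrite !inE /=.
  by case: (boolP (i \in J)) => iJ; rewrite ?andbF// (fsubsetP JK _ iJ).
by rewrite lerDl sumr_ge0.
Qed.

Lemma partial_sumD (V : zmodType) (x y : I -> V) J :
  partial_sum (fun i => x i + y i) J = partial_sum x J + partial_sum y J.
Proof. by rewrite !partial_sumE big_split. Qed.

Lemma partial_sumB (V : zmodType) (x y : I -> V) J :
  partial_sum (fun i => x i - y i) J = partial_sum x J - partial_sum y J.
Proof. by rewrite !partial_sumE sumrB. Qed.

Lemma partial_sumZ (V : lmodType R[i]) (z : R[i]) (x : I -> V) J :
  partial_sum (fun i => z *: x i) J = z *: partial_sum x J.
Proof. by rewrite !partial_sumE scaler_sumr. Qed.

Definition bounded_sums a := exists M : R[i], forall J, partial_sum a J <= M.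

Definition csum c : R[i] := lim (partial_sum (c : I -> R[i]^o) @ totally).
Definition ccvg c := cvg (partial_sum (c : I -> R[i]^o) @ totally).

Lemma nneg_csum a : (forall i, 0 <= a i) -> bounded_sums a ->
  [/\ ccvg a, forall J, partial_sum a J <= csum a &
      forall M, (forall J, partial_sum a J <= M) -> csum a <= M].
Proof.
move=> a0 [M HM].
have ps0 J : 0 <= partial_sum a J by rewrite partial_sumE sumr_ge0.
have psE J : partial_sum a J = (complex.Re (partial_sum a J))%:C%C.
  move: (ps0 J); case: partial_sum => x y; rewrite lecE/= => /andP[/eqP y0 _].
  by rewrite y0.
pose S := [set complex.Re (partial_sum a J) | J in [set: {fset I}]].
have Sub M' : (forall J, partial_sum a J <= M') ->
    ubound S (complex.Re M') /\ M' = (complex.Re M')%:C%C.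
  move=> hM; split.
    by move=> _ [J _ <-]; move: (hM J); rewrite lecE => /andP[].
  have := le_trans (ps0 fset0) (hM fset0).
  by case: M' {hM} => x y; rewrite lecE/= => /andP[/eqP -> _].
have hS : has_sup S.
  split; first by exists (complex.Re (partial_sum a fset0)), fset0.
  by exists (complex.Re M); exact: (Sub _ HM).1.
pose s : R[i] := (sup S)%:C%C.
have ps_le J : partial_sum a J <= s.
  by rewrite psE lecR; apply: (sup_upper_bound hS); exists J.
have cs : partial_sum (a : I -> R[i]^o) @ totally --> (s : R[i]^o).
  apply/(@cvgrPdist_le _ R[i]^o) => e e0.
  have [r r0 er] : exists2 r : R, 0 < r & e = r%:C%C.
    case: e e0 => x y; rewrite ltcE /= => /andP[/eqP y0 x0].
    by exists x; rewrite // y0.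
  have [_ [J0 _ <-] hJ0] := sup_adherent r0 hS.
  exists J0 => // J /= J0J.
  rewrite ger0_norm ?subr_ge0 ?ps_le// er lerBlDr -lerBlDl.
  rewrite (le_trans _ (partial_sum_sub a0 J0J))//.
  by rewrite [leRHS]psE -rmorphB lecR ltW.
have limE : csum a = s by exact: (cvg_lim (@norm_hausdorff _ R[i]^o)).
split.
- by apply: cvgP cs.
- by move=> J; rewrite limE.
- move=> M' hM'; rewrite limE; have [ub ->] := Sub _ hM'.
  by rewrite lecR; apply: ge_sup => //; case: hS.
Qed.

Lemma csumD c b : ccvg c -> ccvg b ->
  ccvg (fun i => c i + b i) /\ csum (fun i => c i + b i) = csum c + csum b.
Proof.
move=> hc hb.
have h : partial_sum ((fun i => c i + b i) : I -> R[i]^o) @ totally --> (csum c + csum b : R[i]^o).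
  rewrite (_ : partial_sum _ = fun J => partial_sum (c : I -> R[i]^o) J + partial_sum (b : I -> R[i]^o) J).
    exact: (@cvgD _ R[i]^o _ _ _ (partial_sum (c : I -> R[i]^o)) (partial_sum (b : I -> R[i]^o)) (csum c) (csum b) hc hb).
  by apply/funext => J; rewrite partial_sumD.
by split; [exact: cvgP h|exact: (cvg_lim (@norm_hausdorff _ R[i]^o))].
Qed.

Lemma csumZ (z : R[i]) c : ccvg c ->
  ccvg (fun i => z * c i) /\ csum (fun i => z * c i) = z * csum c.
Proof.
move=> hc.
have h : partial_sum ((fun i => z * c i) : I -> R[i]^o) @ totally --> (z * csum c : R[i]^o).
  rewrite (_ : partial_sum _ = fun J => z *: partial_sum (c : I -> R[i]^o) J).
    exact: (@cvgZr _ R[i]^o _ _ _ z (partial_sum (c : I -> R[i]^o)) (csum c) hc).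
  by apply/funext => J; rewrite -partial_sumZ.
by split; [exact: cvgP h|exact: (cvg_lim (@norm_hausdorff _ R[i]^o))].
Qed.

Lemma bounded_sumsD a b : bounded_sums a -> bounded_sums b ->
  bounded_sums (fun i => a i + b i).
Proof.
move=> [M hM] [N hN]; exists (M + N) => J.
by rewrite (partial_sumD (V := R[i])) lerD.
Qed.

Lemma bounded_sumsZ (z : R[i]) a : 0 <= z -> bounded_sums a ->
  bounded_sums (fun i => z * a i).
Proof.
move=> z0 [M hM]; exists (z * M) => J.
by rewrite (partial_sumZ (V := R[i]^o)) ler_wpM2l.
Qed.

Lemma le_bounded_sums a b : (forall i, a i <= b i) -> bounded_sums b ->
  bounded_sums a.
Proof.
move=> ab [M hM]; exists M => J; apply: le_trans (hM J).
by rewrite !partial_sumE ler_sum.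
Qed.

Lemma abs_ccvg c b : (forall i, `|c i| <= b i) -> bounded_sums b -> ccvg c.
Proof.
move=> cb bb.
have b0 i : 0 <= b i by exact: le_trans (cb i).
have [cvb _ _] := nneg_csum b0 bb.
have key (x : I -> R[i]) : (forall i, x i \is Num.real) ->
    (forall i, `|x i| <= b i) -> ccvg x.
  move=> xr xb.
  have [||h _ _] := @nneg_csum (fun i => b i + x i).
  - by move=> i; have := xb i; rewrite real_ler_norml// -lerBlDl sub0r => /andP[].
  - apply: (@le_bounded_sums _ (fun i => b i + b i)); last exact: bounded_sumsD.
    by move=> i; rewrite lerD2l; have := xb i; rewrite real_ler_norml// => /andP[].
  have [h' _] := csumZ (-1) cvb.
  have [+ _] := csumD h h'.
  by congr (_ _); apply/funext => i /=; rewrite mulN1r addrAC subrr add0r.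
have cr : ccvg (fun i => 'Re (c i)).
  apply: key => i; first exact: Creal_Re.
  apply: le_trans (cb i).
  rewrite -(@ler_sqr _ `|_|) ?qualifE/= ?normr_ge0//.
  rewrite (normC2_Re_Im (c i)) (real_normK (Creal_Re _)).
  by rewrite lerDl real_exprn_even_ge0 ?Creal_Im.
have ci : ccvg (fun i => 'Im (c i)).
  apply: key => i; first exact: Creal_Im.
  apply: le_trans (cb i).
  rewrite -(@ler_sqr _ `|_|) ?qualifE/= ?normr_ge0//.
  rewrite (normC2_Re_Im (c i)) (real_normK (Creal_Im _)).
  by rewrite lerDr real_exprn_even_ge0 ?Creal_Re.
have [ci' _] := csumZ 'i ci.
have [+ _] := csumD cr ci'.
by congr (_ _); apply/funext => i /=; rewrite -Crect.
Qed.

End Series.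

Section MakeDot.
Variables (C : numClosedFieldType) (V : lmodType C) (f : V -> V -> C).
Hypothesis fl : forall a x y z, f (a *: x + y) z = a * f x z + f y z.
Hypothesis fC : forall x y, f x y = (f y x)^*.
Hypothesis f0 : forall x, x != 0 -> 0 < f x x.

Let fl_lin z : GRing.linear_for *%R (f ^~ z). Proof. by move=> a x y; exact: fl. Qed.
Let fr_lin z : GRing.linear_for (conjC \; *%R) (f z).
Proof. by move=> a x y; rewrite /= (fC z x) (fC z y) (fC z (_ + _)) fl rmorphD rmorphM. Qed.
Let fherm x y : f x y = (-1) ^+ false * (f y x)^*. Proof. by rewrite mul1r. Qed.

Definition make_dot : {dot V for (@conjC C)} :=
  HB.pack f
    (isBilinear.Build C V V C *%R (conjC \; *%R) f
      (fun z => zmod_morphism_linear (fl_lin z)) (fun z => zmod_morphism_linear (fr_lin z))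
      (fun z => scalable_linear (fl_lin z)) (fun z => scalable_linear (fr_lin z)))
    (isHermitianSesquilinear.Build C V false conjC f fherm)
    (isDotProduct.Build C V f f0).
End MakeDot.

Lemma csum_conj (R : realType) (I : choiceType) (c : I -> R[i]) : ccvg c ->
  csum (fun i => (c i)^*) = (csum c)^*.
Proof.
move=> hc; apply: (cvg_lim (@norm_hausdorff _ R[i]^o)).
apply/(@cvgrPdist_le _ R[i]^o) => e e0.
have /(@cvgrPdist_le _ R[i]^o) /(_ e e0) := hc.
apply: filterS => J /=; rewrite !partial_sumE -rmorph_sum -rmorphB norm_conjC.
by rewrite /csum.
Qed.

Section SquareSummable.
Variables (R : realType) (I : choiceType) (H : hilbertType R).
Implicit Types (f g : I -> H).

Definition square_summable f := bounded_sums (fun i => `|f i| ^+ 2 : R[i]).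

Definition l2_pred : {pred I -> H} := [pred f | `[< square_summable f >]].

Lemma hdot_le (x y : H) : `|hdot x y| <= `|x| ^+ 2 + `|y| ^+ 2.
Proof.
apply: le_trans (dot_CauchySchwarz hdot x y) _.
rewrite !hdot_normE !sqrCK//.
have : 0 <= (`|x| - `|y|) ^+ 2 by rewrite real_exprn_even_ge0 ?rpredB ?normr_real.
rewrite sqrrB addrAC subr_ge0; apply: le_trans.
by rewrite mulr2n lerDl mulr_ge0.
Qed.

Lemma normD_le2 (x y : H) : `|x + y| ^+ 2 <= 2 * (`|x| ^+ 2 + `|y| ^+ 2).
Proof.
have -> : 2 * (`|x| ^+ 2 + `|y| ^+ 2) = `|x + y| ^+ 2 + `|x - y| ^+ 2.
  rewrite -!hdot_normE dnormD dnormB mulr2n mulrDl mul1r.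
  by rewrite [RHS]addrACA subrr addr0.
by rewrite lerDl exprn_ge0.
Qed.

Lemma square_summable_hdot f g : square_summable f -> square_summable g ->
  ccvg (fun i => hdot (f i) (g i)).
Proof.
move=> hf hg; apply: (@abs_ccvg _ _ _ (fun i => `|f i| ^+ 2 + `|g i| ^+ 2)).
  by move=> i; exact: hdot_le.
exact: bounded_sumsD.
Qed.

Lemma l2_pred_submod : submod_closed l2_pred.
Proof.
split.
  rewrite inE; exists 0 => J.
  by rewrite partial_sumE big1// => i _; rewrite normr0 expr0n.
move=> a f g; rewrite !inE => hf hg.
have h : bounded_sums (fun i => (2 * `|a| ^+ 2) * `|f i| ^+ 2 + 2 * `|g i| ^+ 2).
  by apply: bounded_sumsD; apply: bounded_sumsZ => //; rewrite mulr_ge0 ?exprn_ge0.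
apply: le_bounded_sums h => i /=.
rewrite -mulrA -exprMn -normrZ -mulrDr.
have -> : (a *: f + g) i = a *: f i + g i by [].
exact: normD_le2.
Qed.
HB.instance Definition _ := GRing.isSubmodClosed.Build R[i] (I -> H) l2_pred l2_pred_submod.

(* The Hilbert sum of copies of H indexed by I; for I = 'I_d it is the d-fold
   orthogonal sum of H with itself. *)
Record l2 := L2 { l2_fun :> I -> H; _ : l2_fun \in l2_pred }.
HB.instance Definition _ := [isSub for l2_fun].
HB.instance Definition _ := [Choice of l2 by <:].
HB.instance Definition _ := [SubChoice_isSubLmodule of l2 by <:].

Lemma l2P (f : l2) : square_summable f.
Proof. by case: f => f /= /asboolW. Qed.

Lemma l2_ext (f g : l2) : f =1 g -> f = g.
Proof. by move=> fg; apply/val_inj/funext. Qed.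

Definition l2_dot_fun (f g : l2) : R[i] := csum (fun i => hdot (f i) (g i)).

Fact l2_dotl a (x y z : l2) :
  l2_dot_fun (a *: x + y) z = a * l2_dot_fun x z + l2_dot_fun y z.
Proof.
have [h1 <-] := csumZ a (square_summable_hdot (l2P x) (l2P z)).
have [_ <-] := csumD h1 (square_summable_hdot (l2P y) (l2P z)).
congr csum; apply/funext => i.
by rewrite -(dotZl hdot) -linearDl.
Qed.

Fact l2_dotC (x y : l2) : l2_dot_fun x y = (l2_dot_fun y x)^*.
Proof.
rewrite -csum_conj; last exact: square_summable_hdot (l2P y) (l2P x).
by congr csum; apply/funext => i; rewrite (dotC hdot).
Qed.

Lemma l2_dot_sup (f : l2) :
  (forall J, partial_sum (fun i => `|f i| ^+ 2 : R[i]) J <= l2_dot_fun f f) /\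
  (forall M, (forall J, partial_sum (fun i => `|f i| ^+ 2 : R[i]) J <= M) ->
     l2_dot_fun f f <= M).
Proof.
have [|_] := @nneg_csum R I (fun i => `|f i| ^+ 2) _ (l2P f).
  by move=> i; rewrite exprn_ge0.
have -> : csum (fun i => `|f i| ^+ 2) = l2_dot_fun f f.
  by congr csum; apply/funext => i; rewrite hdot_normE.
by [].
Qed.

Lemma l2_norm_le (f : l2) i : `|f i| ^+ 2 <= l2_dot_fun f f.
Proof.
by have [/(_ [fset i]%fset) + _] := l2_dot_sup f; rewrite partial_sumE big_seq_fset1.
Qed.

Fact l2_dot0 (x : l2) : x != 0 -> 0 < l2_dot_fun x x.
Proof.
move=> x0; have [i xi] : exists i, x i != 0.
  apply: contrapT => h; move/negP: x0; apply; apply/eqP/l2_ext => i.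
  by apply/eqP/negPn/negP => xi; apply: h; exists i.
by apply: lt_le_trans (l2_norm_le x i); rewrite exprn_gt0 ?normr_gt0.
Qed.

Definition l2_dot := make_dot l2_dotl l2_dotC l2_dot0.

Fact l2_dot_complete : dot_complete l2_dot.
Proof.
move=> u cu.
have cu' (e : R[i]) : 0 < e -> exists N, forall m n, (N <= m)%N -> (N <= n)%N ->
    forall J, \sum_(i <- enum_fset J) `|u m i - u n i| ^+ 2 <= e.
  move=> /cu[N hN]; exists N => m n Nm Nn J.
  apply: le_trans (hN m n Nm Nn).
  by have [/(_ J) + _] := l2_dot_sup (u m - u n); rewrite partial_sumE.
have cvgi i : cvgn (fun n => u n i).
  apply: cauchy_cvg; apply: cauchy_exP => e e0.
  have [N hN] := cu' ((e / 2) ^+ 2) (exprn_gt0 _ (divr_gt0 e0 (ltr0n _ 2))).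
  exists (u N i); exists N => // n /= Nn.
  have := hN N n (leqnn _) Nn [fset i]%fset; rewrite big_seq_fset1 => h.
  rewrite -ball_normE /=.
  have e20 : 0 <= e / 2 by rewrite divr_ge0// ltW.
  move: h; rewrite ler_sqr ?qualifE//= => h; apply: le_lt_trans h _.
  by rewrite ltr_pdivrMr// ltr_pMr// ltr1n.
pose f i := lim ((fun n => u n i) @ \oo).
have fE i (e : R[i]) : 0 < e -> exists N, forall n, (N <= n)%N -> `|u n i - f i| <= e.
  move=> e0; have /cvgrPdist_le /(_ e e0) [N _ hN] := cvgi i.
  by exists N => n /hN; rewrite /= distrC.
have fs (s : seq I) (e : R[i]) : 0 < e -> exists N, forall n, (N <= n)%N ->
    forall i, i \in s -> `|u n i - f i| ^+ 2 <= e.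
  move=> e0; elim: s => [|j s [N hN]]; first by exists 0%N.
  have [M hM] : exists M, forall n, (M <= n)%N -> `|u n j - f j| <= sqrtC e.
    by apply: fE; rewrite sqrtC_gt0.
  exists (maxn N M) => n; rewrite geq_max => /andP[Nn Mn] i.
  rewrite inE => /orP[/eqP ->|]; last exact: hN.
  by rewrite -[leRHS]sqrtCK ler_sqr ?qualifE//= ?hM// sqrtC_ge0 ltW.
have fJ (e : R[i]) : 0 < e -> exists N, forall m, (N <= m)%N -> forall J,
    partial_sum (fun i => `|u m i - f i| ^+ 2) J <= e.
  move=> e0; have e4 : 0 < e / 4 by rewrite divr_gt0.
  have [N hN] := cu' _ e4; exists N => m Nm J; rewrite partial_sumE.
  pose c : R[i] := (size (enum_fset J)).+1%:R.
  have c0 : 0 < c by rewrite ltr0n.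
  have [M hM] := fs (enum_fset J) (e / 4 / c) (divr_gt0 e4 c0).
  pose n := maxn N M.
  have h1 := hN m n Nm (leq_maxl _ _) J.
  have h2 : \sum_(i <- enum_fset J) `|u n i - f i| ^+ 2 <= e / 4.
    apply: (@le_trans _ _ (\sum_(i <- enum_fset J) (e / 4 / c))).
      rewrite big_seq [leRHS]big_seq; apply: ler_sum => i iJ.
      by rewrite hM// leq_maxr.
    rewrite big_const_seq count_predT iter_addr_0; set d := e / 4 in e4 *.
    rewrite -[leLHS]mulr_natr -mulrA ler_piMr//; first exact: ltW.
    by rewrite mulrC ler_pdivrMr// mul1r ler_nat.
  apply: (@le_trans _ _ (\sum_(i <- enum_fset J)
     (2 * `|u m i - u n i| ^+ 2 + 2 * `|u n i - f i| ^+ 2))).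
    apply: ler_sum => i _.
    rewrite -mulrDr; have := normD_le2 (u m i - u n i) (u n i - f i).
    by rewrite addrA subrK.
  rewrite big_split/= -!mulr_sumr -mulrDr.
  have -> : e = 2 * (e / 4 + e / 4) by field.
  by rewrite ler_pM2l// lerD.
have fl2 : f \in l2_pred.
  have [N hN] := fJ 1 ltr01.
  rewrite (_ : f = (u N : I -> H) - ((u N : I -> H) - f)); last by rewrite opprB addrC subrK.
  apply: rpredB; first by case: (u N).
  by rewrite inE; exists 1 => J; exact: hN.
exists (L2 fl2) => e /fJ[N hN]; exists N => n Nn.
by have [_ +] := l2_dot_sup (u n - L2 fl2); apply => J; exact: hN.
Qed.

HB.instance Definition _ := Lmodule_isHilbert.Build R l2 l2_dot_complete.

End SquareSummable.

Lemma hilbert_seq_complete (R : realType) (H : hilbertType R) :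
  dot_complete (hdot : H -> H -> R[i]).
Proof.
move=> u cu.
have : cvgn u.
  apply: cauchy_cvg; apply: cauchy_exP => e e0.
  have e2 : 0 < e / 2 by rewrite divr_gt0.
  have [N hN] := cu ((e / 2) ^+ 2) (exprn_gt0 2 e2).
  exists (u N); exists N => // n /= Nn.
  have := hN N n (leqnn _) Nn; rewrite hdot_normE -ball_normE /=.
  have e20 := ltW e2.
  rewrite ler_sqr ?qualifE//= => h; apply: le_lt_trans h _.
  by rewrite ltr_pdivrMr// ltr_pMr// ltr1n.
move=> /cvgrPdist_le cl; exists (lim (u @ \oo)) => e e0.
have [|N _ hN] := cl (sqrtC e); first by rewrite sqrtC_gt0.
exists N => n /hN /=; rewrite hdot_normE distrC => h.
by rewrite -[leRHS]sqrtCK ler_sqr ?qualifE//= sqrtC_ge0 ltW.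
Qed.

Section HProd.
Variables (R : realType) (H K : hilbertType R).

(* An alias, since the norm of the product type is the sup norm. *)
Definition hprod : Type := (H * K)%type.
HB.instance Definition _ := GRing.Lmodule.copy hprod (H * K)%type.

Definition hprod_dot_fun (x y : hprod) : R[i] := hdot x.1 y.1 + hdot x.2 y.2.

Fact hprod_dotl a (x y z : hprod) :
  hprod_dot_fun (a *: x + y) z = a * hprod_dot_fun x z + hprod_dot_fun y z.
Proof.
rewrite /hprod_dot_fun /= linearDl/= (linearDl hdot)/= !dotZl mulrDr.
exact: addrACA.
Qed.

Fact hprod_dotC (x y : hprod) : hprod_dot_fun x y = (hprod_dot_fun y x)^*.
Proof. by rewrite /hprod_dot_fun rmorphD; congr (_ + _); exact: (dotC hdot). Qed.

Fact hprod_dot0 (x : hprod) : x != 0 -> 0 < hprod_dot_fun x x.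
Proof.
move=> x0; rewrite lt_def addr_ge0 ?dnorm_ge0// andbT.
apply: contra x0; rewrite paddr_eq0 ?dnorm_ge0// !dnorm_eq0.
by case: x => a b /= /andP[/eqP-> /eqP->].
Qed.

Definition hprod_dot := make_dot hprod_dotl hprod_dotC hprod_dot0.

Fact hprod_dot_complete : dot_complete hprod_dot.
Proof.
move=> u cu.
have le1 (x : hprod) : hdot x.1 x.1 <= hprod_dot x x by rewrite lerDl dnorm_ge0.
have le2 (x : hprod) : hdot x.2 x.2 <= hprod_dot x x by rewrite lerDr dnorm_ge0.
have [|l1 h1] := @hilbert_seq_complete _ H (fun n => (u n).1).
  move=> e /cu[N hN]; exists N => m n Nm Nn.
  exact: le_trans (le1 (u m - u n)) (hN _ _ Nm Nn).
have [|l2 h2] := @hilbert_seq_complete _ K (fun n => (u n).2).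
  move=> e /cu[N hN]; exists N => m n Nm Nn.
  exact: le_trans (le2 (u m - u n)) (hN _ _ Nm Nn).
exists (l1, l2) => e e0; have e2 : 0 < e / 2 by rewrite divr_gt0.
have [N1 hN1] := h1 _ e2; have [N2 hN2] := h2 _ e2.
exists (maxn N1 N2) => n; rewrite geq_max => /andP[n1 n2].
by rewrite [leRHS](splitr e) lerD ?hN1 ?hN2.
Qed.

HB.instance Definition _ := Lmodule_isHilbert.Build R hprod hprod_dot_complete.

Definition hprod_inl (x : H) : hprod := (x, 0).
Definition hprod_inr (y : K) : hprod := (0, y).

End HProd.
Arguments hprod_inl {R H K} x.
Arguments hprod_inr {R H K} y.

Section HSubspace.
Variables (R : realType) (H : hilbertType R).

Record hsubspace := HSubspace {
  hsub_pred : {pred H};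
  hsub_submod : submod_closed hsub_pred;
  hsub_closed : closed [set` hsub_pred] }.

Variable S : hsubspace.
HB.instance Definition _ :=
  GRing.isSubmodClosed.Build R[i] H (hsub_pred S) (hsub_submod S).

Record hsub := HSub { hsub_val : H; _ : hsub_val \in hsub_pred S }.
HB.instance Definition _ := [isSub for hsub_val].
HB.instance Definition _ := [Choice of hsub by <:].
HB.instance Definition _ := [SubChoice_isSubLmodule of hsub by <:].

Definition hsub_dot_fun (x y : hsub) : R[i] := hdot (hsub_val x) (hsub_val y).

Fact hsub_dotl a (x y z : hsub) :
  hsub_dot_fun (a *: x + y) z = a * hsub_dot_fun x z + hsub_dot_fun y z.
Proof. by rewrite /hsub_dot_fun -(dotZl hdot) -linearDl. Qed.

Fact hsub_dotC (x y : hsub) : hsub_dot_fun x y = (hsub_dot_fun y x)^*.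
Proof. exact: (dotC hdot). Qed.

Fact hsub_dot0 (x : hsub) : x != 0 -> 0 < hsub_dot_fun x x.
Proof.
move=> x0; rewrite dnorm_gt0; apply: contra x0 => /eqP x0.
exact/eqP/val_inj.
Qed.

Definition hsub_dot := make_dot hsub_dotl hsub_dotC hsub_dot0.

Fact hsub_dot_complete : dot_complete hsub_dot.
Proof.
move=> u cu; have [|l hl] := @hilbert_seq_complete _ H (fun n => hsub_val (u n)).
  exact: cu.
have lS : l \in hsub_pred S.
  have cl : (fun n => hsub_val (u n)) @ \oo --> l.
    apply/cvgrPdist_le => e e0; have [N hN] := hl _ (exprn_gt0 2 e0).
    exists N => // n /= /hN; rewrite hdot_normE distrC ler_sqr ?qualifE//=.
    exact: ltW.
  apply: (@closed_cvg _ _ \oo _ (fun n => hsub_val (u n)) [set` hsub_pred S] (@hsub_closed S) _ _ cl).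
  by exists 0%N => // n _ /=; case: (u n).
by exists (HSub lS) => e /hl.
Qed.

HB.instance Definition _ := Lmodule_isHilbert.Build R hsub hsub_dot_complete.
End HSubspace.
Coercion hsub : hsubspace >-> Sortclass.
Arguments hsub_val {R H S} _.

HB.structure Definition BoundedOp (R : realType) (H K : hilbertType R) :=
  {f of @GRing.Linear R[i] H K *:%R f & @isContinuous H K f}.
Notation "{ 'bop' H -> K }" := (@BoundedOp.type _ H%type K%type)
  (H at level 98, K at level 99, format "{ 'bop'  H  ->  K }") : type_scope.

HB.instance Definition _ (R : realType) (H K : hilbertType R) :=
  gen_eqMixin {bop H -> K}.
HB.instance Definition _ (R : realType) (H K : hilbertType R) :=
  gen_choiceMixin {bop H -> K}.

Section MakeBop.
Variables (R : realType) (H K : hilbertType R) (f : H -> K) (M : R[i]).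
Hypothesis flin : linear f.
Hypothesis fM : forall x, `|f x| <= M * `|x|.

Fact make_bop_continuous : continuous f.
Proof.
move=> x; apply/cvgrPdist_le => e e0.
pose r := `|M| + 1; have r0 : 0 < r by rewrite ltr_wpDl.
apply: filterS (nbhsx_ballx x (e / r) (divr_gt0 e0 r0)) => y.
rewrite -ball_normE /= => xy.
have -> : f x - f y = f (x - y).
  by rewrite (addrC x) -[- y]scaleN1r flin scaleN1r addrC.
have [z0|z0] := eqVneq (x - y) 0.
  rewrite z0; have := fM 0; rewrite normr0 mulr0 => h.
  exact: le_trans h (ltW e0).
apply: le_trans (fM _) _.
have M0 : 0 <= M.
  have := le_trans (normr_ge0 _) (fM (x - y)).
  by rewrite pmulr_lge0// normr_gt0.
apply: (@le_trans _ _ (r * (e / r))).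
  rewrite ler_pM//; last exact: ltW.
  by rewrite /r (ger0_norm M0) lerDl.
by rewrite mulrC divfK// gt_eqF.
Qed.

Definition make_bop : {bop H -> K} :=
  HB.pack f (GRing.isLinear.Build R[i] H K *:%R f flin)
    (isContinuous.Build H K f make_bop_continuous).
End MakeBop.

Section Operators.
Variable R : realType.
Implicit Types H K L : hilbertType R.

Lemma bop_bounded H K (T : {bop H -> K}) :
  exists2 M : R[i], 0 < M & forall x, `|T x| <= M * `|x|.
Proof.
have /linear_bounded_continuous/linear_boundedP/pinfty_ex_gt0[M M0 hM] :
  continuous (T : {linear H -> K}) by exact: cts_fun.
by exists M.
Qed.

Fact bop0_bounded H K (x : H) : `|(\0 : H -> K) x| <= 0 * `|x|.
Proof. by rewrite normr0 mul0r. Qed.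
Definition bop0 H K : {bop H -> K} :=
  make_bop (f := \0 : H -> K) (@linearP _ _ _ _ (\0 : {linear H -> K})) (@bop0_bounded H K).

Fact bop_id_bounded H (x : H) : `|idfun x| <= 1 * `|x|.
Proof. by rewrite mul1r. Qed.
Definition bop_id H : {bop H -> H} :=
  make_bop (f := idfun : H -> H) (fun _ _ _ => erefl) (@bop_id_bounded H).

Definition bop_comp H K L (S : {bop K -> L}) (T : {bop H -> K}) : {bop H -> L} :=
  HB.pack (S \o T : H -> L)
    (GRing.isLinear.Build R[i] H L *:%R (S \o T) (linearP (S \o T)))
    (isContinuous.Build H L (S \o T) (fun x => continuous_comp (cts_fun (s := T) x) (cts_fun (s := S) (T x)))).

Definition contractive_op H K (T : {bop H -> K}) := forall x, `|T x| <= `|x|.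

Definition unitary H K (U : {bop H -> K}) :=
  (forall x y, hdot (U x) (U y) = hdot x y) /\ (forall y, exists x, U x = y).

(* adj and bop_sqrt below select operators by choice; every bounded operator
   has exactly one adjoint, every positive one exactly one positive root, so
   the default value bop0 only concerns the root of a non-positive map. *)
Definition is_adj H K (T : {bop H -> K}) (S : {bop K -> H}) :=
  forall x y, hdot (T x) y = hdot x (S y).
Definition adj H K (T : {bop H -> K}) : {bop K -> H} :=
  xget (bop0 K H) [set S | is_adj T S].

(* Over the complex scalars, 0 <= z says in particular that z is real, so that
   a positive operator is self-adjoint. *)
Definition positive H (P : H -> H) := forall x, 0 <= hdot (P x) x.

Definition is_sqrt H (P : H -> H) (D : {bop H -> H}) :=
  positive D /\ forall x, D (D x) = P x.
Definition bop_sqrt H (P : H -> H) : {bop H -> H} :=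
  xget (bop0 H H) [set D | is_sqrt P D].

Definition defect H K (T : {bop H -> K}) : {bop H -> H} :=
  bop_sqrt (fun x => x - adj T (T x)).
Definition defect_star H K (T : {bop H -> K}) : {bop K -> K} :=
  bop_sqrt (fun y => y - T (adj T y)).

Definition ran_closure_pred H K (T : {bop H -> K}) : {pred K} :=
  [pred y | `[< closure (range T) y >]].

Lemma closureNP H (E : set H) x :
  closure E x <-> forall e : R[i], 0 < e -> exists2 y, E y & `|x - y| <= e.
Proof.
split=> [h e e0|h B /nbhs_ballP[e /= e0 eB]].
  have [y [Ey]] := h _ (nbhsx_ballx x e e0).
  by rewrite -ball_normE /= => /ltW xy; exists y.
have [|y Ey xy] := h (e / 2); first by rewrite divr_gt0.
exists y; split => //; apply: eB; rewrite -ball_normE /=.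
by apply: le_lt_trans xy _; rewrite ltr_pdivrMr// ltr_pMr// ltr1n.
Qed.

Fact ran_closure_submod H K (T : {bop H -> K}) : submod_closed (ran_closure_pred T).
Proof.
split.
  rewrite inE /=; apply: subset_closure; exists 0 => //; exact: linear0.
move=> a x y; rewrite !inE /= => /closureNP hx /closureNP hy; apply/closureNP => e e0.
pose r := `|a| + 1; have r0 : 0 < r by rewrite ltr_wpDl.
have e2 : 0 < e / 2 by rewrite divr_gt0.
have [_ [u _ <-] xu] := hx (e / 2 / r) (divr_gt0 e2 r0).
have [_ [v _ <-] yv] := hy (e / 2) e2.
exists (a *: T u + T v); first by exists (a *: u + v) => //; exact: linearP.
rewrite opprD addrACA -scalerBr (le_trans (ler_normD _ _))// (splitr e) lerD//.
rewrite normrZ; apply: (@le_trans _ _ (r * (e / 2 / r))).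
  by rewrite ler_pM// lerDl.
by rewrite mulrC divfK// gt_eqF.
Qed.

Fact ran_closure_closed H K (T : {bop H -> K}) : closed [set` ran_closure_pred T].
Proof.
rewrite (_ : [set` _] = closure (range T)); first exact: closed_closure.
by apply/seteqP; split => y; rewrite /= inE.
Qed.

Definition ran_closure H K (T : {bop H -> K}) : hsubspace K :=
  HSubspace (@ran_closure_submod H K T) (@ran_closure_closed H K T).

Definition defect_space H K (T : {bop H -> K}) : hsubspace H := ran_closure (defect T).
Definition defect_star_space H K (T : {bop H -> K}) : hsubspace K :=
  ran_closure (defect_star T).

(* x seen as a vector of S; only meant for x in S, and 0 elsewhere. *)
Definition corestr H (S : hsubspace H) (x : H) : hsub S := insubd 0 x.

Fact fst_bounded H K (x : hprod H K) : `|x.1| <= 1 * `|x|.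
Proof.
rewrite mul1r -(@ler_sqr _ `|x.1|) ?qualifE//= -!hdot_normE.
by rewrite [leRHS]/(_ + _) lerDl dnorm_ge0.
Qed.
Fact snd_bounded H K (x : hprod H K) : `|x.2| <= 1 * `|x|.
Proof.
rewrite mul1r -(@ler_sqr _ `|x.2|) ?qualifE//= -!hdot_normE.
by rewrite [leRHS]/(_ + _) lerDr dnorm_ge0.
Qed.
Definition bop_fst H K : {bop hprod H K -> H} :=
  make_bop (f := fst : hprod H K -> H) (fun _ _ _ => erefl) (@fst_bounded H K).
Definition bop_snd H K : {bop hprod H K -> K} :=
  make_bop (f := snd : hprod H K -> K) (fun _ _ _ => erefl) (@snd_bounded H K).

Section L2Maps.
Variable I : choiceType.

Fact l2_map_subproof H K (T : {bop H -> K}) (f : l2 I H) :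
  (fun i => T (f i)) \in @l2_pred R I K.
Proof.
have [M M0 hM] := bop_bounded T; rewrite inE.
have := bounded_sumsZ (exprn_ge0 2 (ltW M0)) (l2P f).
apply: le_bounded_sums => i /=.
by rewrite -exprMn ler_sqr ?qualifE//= mulr_ge0// ltW.
Qed.
Definition l2_map_fun H K (T : {bop H -> K}) (f : l2 I H) : l2 I K :=
  L2 (l2_map_subproof T f).

Fact l2_map_linear H K (T : {bop H -> K}) : linear (l2_map_fun T).
Proof. by move=> a f g; apply: l2_ext => i; exact: linearP. Qed.

Fact l2_map_bounded H K (T : {bop H -> K}) :
  exists M : R[i], forall f, `|l2_map_fun T f| <= M * `|f|.
Proof.
have [M M0 hM] := bop_bounded T; exists M => f.
have Mf : 0 <= M * `|f| by rewrite mulr_ge0// ltW.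
rewrite -(@ler_sqr _ `|_|) ?qualifE//= exprMn -!hdot_normE.
have [_ +] := l2_dot_sup (l2_map_fun T f); apply => J.
have [/(_ J) h _] := l2_dot_sup f.
apply: (@le_trans _ _ (M ^+ 2 * partial_sum (fun i => `|f i| ^+ 2) J)); last first.
  by rewrite ler_wpM2l// exprn_ge0// ltW.
rewrite !partial_sumE mulr_sumr; apply: ler_sum => i _ /=.
by rewrite -exprMn ler_sqr ?qualifE//= mulr_ge0// ltW.
Qed.

Definition l2_map H K (T : {bop H -> K}) : {bop l2 I H -> l2 I K} :=
  make_bop (@l2_map_linear H K T) (projT2 (cid (l2_map_bounded T))).

Fact l2_delta_subproof H (i : I) (x : H) :
  (fun j => if j == i then x else 0) \in @l2_pred R I H.
Proof.
rewrite inE; exists (`|x| ^+ 2) => J; rewrite partial_sumE.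
have [iJ|iJ] := boolP (i \in J).
  rewrite (big_fsetD1 i)//= eqxx big_seq big1 ?addr0// => j.
  by rewrite in_fsetD1 => /andP[/negPf -> _]; rewrite normr0 expr0n.
rewrite big_seq big1 ?exprn_ge0// => j jJ.
rewrite (_ : j == i = false) ?normr0 ?expr0n//.
by apply: contraNF iJ => /eqP <-.
Qed.
Definition l2_delta H (i : I) (x : H) : l2 I H := L2 (l2_delta_subproof i x).
End L2Maps.

Section Rows.
Variable d : nat.

(* The row [T_1 ... T_d]. *)
Definition row_op_fun H K (T : 'I_d -> {bop H -> K}) (x : l2 'I_d H) : K :=
  \sum_(i < d) T i (x i).

Fact row_op_linear H K (T : 'I_d -> {bop H -> K}) : linear (row_op_fun T).
Proof.
move=> a x y; rewrite /row_op_fun scaler_sumr -big_split/=.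
by apply: eq_bigr => i _; exact: linearP.
Qed.

Fact row_op_bounded H K (T : 'I_d -> {bop H -> K}) :
  exists M : R[i], forall x, `|row_op_fun T x| <= M * `|x|.
Proof.
have /choice[M hM] i : exists M : R[i], 0 < M /\ forall x, `|T i x| <= M * `|x|.
  by have [M M0 ?] := bop_bounded (T i); exists M.
exists (\sum_i M i) => x; rewrite mulr_suml.
apply: le_trans (ler_norm_sum _ _ _) _; apply: ler_sum => i _.
have [M0 h] := hM i; apply: le_trans (h _) _; rewrite ler_pM2l//.
by rewrite -(@ler_sqr _ `|_|) ?qualifE//= -(hdot_normE x); exact: l2_norm_le.
Qed.

Definition row_op H K (T : 'I_d -> {bop H -> K}) : {bop l2 'I_d H -> K} :=
  make_bop (@row_op_linear H K T) (projT2 (cid (row_op_bounded T))).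

End Rows.
End Operators.
Arguments corestr {R H S} x.
Arguments l2_map {R I H K} T.

Section L2Delta.
Variables (R : realType) (I : choiceType).

Lemma hdot_l2_delta (H : hilbertType R) (i : I) (x : H) (f : l2 I H) :
  hdot (l2_delta i x) f = hdot x (f i).
Proof.
apply: (cvg_lim (@norm_hausdorff _ R[i]^o)).
apply: (@cvg_near_cst _ _ _ _ _ _); exists [fset i]%fset => // J /= iJ.
rewrite partial_sumE (big_fsetD1 i)/= ?eqxx; last first.
  by apply: (fsubsetP iJ); rewrite in_fset1.
rewrite big_seq big1 ?addr0// => j.
by rewrite in_fsetD1 => /andP[/negPf -> _]; rewrite linear0l.
Qed.

Lemma l2_map_delta (H K : hilbertType R) (T : {bop H -> K}) (i : I) (x : H) :
  l2_map T (l2_delta i x) = l2_delta i (T x).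
Proof. by apply: l2_ext => j /=; case: eqP => // _; rewrite linear0. Qed.
End L2Delta.

Definition lspan (C : nzRingType) (V : lmodType C) (S : set V) : set V :=
  [set v | exists2 s : seq (C * V), (forall p, p \in s -> S p.2) &
                                    v = \sum_(p <- s) p.1 *: p.2].

(* The full Fock space over C^d has the orthonormal basis (e_w), w a word, so
   its tensor product with K is the Hilbert sum of the copies e_w (x) K: here
   e_w (x) x is l2_delta w x and I (x) T is l2_map T (cf. l2_map_delta). *)
Notation fock d K := (l2 (seq (ordinal d)) K).

(* Norm limit of the finite partial sums along the directed set of finite sets. *)
Definition unordered_sum (R : realType) (I : choiceType) (H : hilbertType R) (x : I -> H) : H := summability.sum x.

Section Tuples.
Variables (R : realType) (d : nat).


Fixpoint word_op (H : hilbertType R) (T : 'I_d -> {bop H -> H}) (w : seq 'I_d) :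
    {bop H -> H} :=
  if w is i :: w' then bop_comp (T i) (word_op T w') else bop_id H.

Definition row_contraction (H : hilbertType R) (T : 'I_d -> {bop H -> H}) :=
  positive (fun x => x - \sum_(i < d) T i (adj (T i) x)).

(* theta_A: the inner sum is over all words w, with e_k (x) e_w = e_(k :: w). *)
Definition char_fun (H : hilbertType R) (A : 'I_d -> {bop H -> H})
    (x : defect_space (row_op A)) : fock d (defect_star_space (row_op A)) :=
  - l2_delta [::] (corestr (row_op A (hsub_val x)))
  + \sum_(k < d) unordered_sum (fun w => l2_delta (k :: w)
      (corestr (defect_star (row_op A)
         (adj (word_op A w) (defect (row_op A) (hsub_val x) k))))).
End Tuples.

Section Lifting.
Variables (R : realType) (d : nat) (HC HA : hilbertType R).
Variables (C : 'I_d -> {bop HC -> HC}) (A : 'I_d -> {bop HA -> HA}).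
Variables (B : 'I_d -> {bop HC -> HA}).
Variables (E : 'I_d -> {bop hprod HC HA -> hprod HC HA}).

Definition lower_triangular_lifting := forall i x, E i x = (C i x.1, B i x.1 + A i x.2).

Definition minimal_lifting :=
  closure (lspan [set y : hprod HC HA |
    exists (w : seq 'I_d) (x : HC), y = word_op E w (hprod_inl x)]) = setT.

Variable gamma : {bop defect_star_space (row_op A) -> defect_space (row_op C)}.

Definition is_lift_char_fun
    (Theta : {bop defect_space (row_op E) -> fock d (defect_space (row_op C))}) :=
  (forall j (hc : HC),
     Theta (corestr (defect (row_op E) (l2_delta j (hprod_inl hc)))) =
       l2_delta [::] (corestr (defect (row_op C) (l2_delta j hc))
                      - gamma (corestr (defect_star (row_op A) (B j hc))))
       - unordered_sum (fun w => if (0 < size w)%N then l2_delta w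
           (gamma (corestr (defect_star (row_op A) (adj (word_op A w) (B j hc)))))
           else 0)) /\
  (forall j (ha : HA),
     Theta (corestr (defect (row_op E) (l2_delta j (hprod_inr ha)))) =
       - l2_delta [::]
           (gamma (corestr (row_op A (defect (row_op A) (l2_delta j ha)))))
       + \sum_(k < d) unordered_sum (fun w => l2_delta (k :: w)
           (gamma (corestr (defect_star (row_op A) (adj (word_op A w)
              (defect (row_op A) (defect (row_op A) (l2_delta j ha)) k))))))).

(* theta_{C,E}: the bounded operator with the prescribed values. *)
Definition lift_char_fun :
    {bop defect_space (row_op E) -> fock d (defect_space (row_op C))} :=
  xget (bop0 _ _) [set Theta | is_lift_char_fun Theta].
End Lifting.
Arguments lift_char_fun {R d HC HA} C A B E gamma.

(* Main.v *)
(* Write v = gamma^* D_C x_C for x = (x_C, x_A).  Taking adjoints in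
   B^* = D_C gamma D_{*,A} gives B x_C = D_{*,A} v, and the intertwining relations
   A D_A = D_{*,A} A and D_A A^* = A^* D_{*,A} turn
   |x|^2 - |E x|^2 into |D_{*,gamma} D_C x_C|^2 + |- A^* v + D_A x_A|^2.  The
   prescription for sigma is therefore isometric on the range of D_E; being block
   triangular with diagonal blocks of dense range, it extends to a unitary.

   theta_A is expressed through the Poisson kernel W y = \sum_w e_w (x) D_{*,A} A_w^* y,
   which satisfies W y = e_0 (x) D_{*,A} y + \sum_k e_k (x) W A_k^* y.  This yields
   theta_A (- A^* v) = e_0 (x) v - W (D_{*,A} v), from which both defining equations of
   theta_{C,E} follow for the candidate [D_{*,gamma}, (I (x) gamma) theta_A] sigma.
   They determine a bounded operator because the vectors D_E iota_j h span a dense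
   subspace. *)
Require Import Defs.
From mathcomp Require Import all_boot all_order all_algebra sesquilinear.
From mathcomp Require Import finmap complex ring lra.
From mathcomp Require Import boolp classical_sets functions reals topology normedtype.
Set Implicit Arguments.
Unset Strict Implicit.
Unset Printing Implicit Defensive.
Import Order.TTheory GRing.Theory Num.Theory Num.Def.
Import numFieldNormedType.Exports.
Local Open Scope ring_scope.

(** * Real-valued norm and Riesz representation *)

Section RealNorm.
Variable R : realType.
Implicit Types H K : hilbertType R.

(** Adjoints, square roots and [lift_char_fun] are selected by choice with a default value, so each
    can be used only after an object with the specifying property has been exhibited. Hence the
    Riesz theorem, and a square root built by an iteration with explicit rate in place of a
    functional calculus. The rate is used twice. The approximants are polynomials in K, so a
    relation K2 T = T K1 holds for them as well, and the error bound passes it to the roots; this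
    yields the intertwining of A with its defect operators. Applied with T a given positive root, it
    also yields uniqueness of that root, so the error bound is available for whichever root was
    chosen. Similarly the candidate for theta_{C,E} serves first to show that the defining equations
    have a bounded solution, and only then to identify the chosen one. Finally, [corestr] is 0 off
    its subspace, so each use needs a membership proof, which is again an intertwining relation. *)

Lemma real_complex_ge0 (z : R[i]) : 0 <= z -> z = (complex.Re z)%:C%C.
Proof. by case: z => x y; rewrite lecE/= => /andP[/eqP ->]. Qed.

(* The order of R[i] is partial, which keeps lra from applying; estimates are
   carried out on the real parts of the norm and of the inner product. *)
Definition rnorm H (x : H) : R := complex.Re `|x|.
Definition rdot H (x y : H) : R := complex.Re (hdot x y).

Lemma rnormE H (x : H) : `|x| = (rnorm x)%:C%C.
Proof. exact: real_complex_ge0. Qed.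

Lemma rnorm_ge0 H (x : H) : 0 <= rnorm x.
Proof. rewrite -lecR -rnormE; exact: normr_ge0. Qed.

Lemma rnormD H (x y : H) : rnorm (x + y) <= rnorm x + rnorm y.
Proof. rewrite -lecR [leRHS]rmorphD /= -!rnormE; exact: ler_normD. Qed.

Lemma rnormN H (x : H) : rnorm (- x) = rnorm x.
Proof. by rewrite /rnorm normrN. Qed.

Lemma rnormB H (x y : H) : rnorm (x - y) = rnorm (y - x).
Proof. by rewrite /rnorm distrC. Qed.

Lemma rnorm0 H : rnorm (0 : H) = 0.
Proof. by rewrite /rnorm normr0. Qed.

Lemma rnorm_eq0 H (x : H) : rnorm x = 0 -> x = 0.
Proof. by move=> h; apply/normr0_eq0; rewrite rnormE h. Qed.

Lemma rnormZ H (a : R[i]) (x : H) : rnorm (a *: x) = complex.Re `|a| * rnorm x.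
Proof.
by apply: (@complexI R); rewrite [RHS]rmorphM /= -!rnormE -(real_complex_ge0 (normr_ge0 a))
  normrZ.
Qed.

Lemma rnormZr H (a : R) (x : H) : rnorm (a%:C%C *: x) = `|a| * rnorm x.
Proof. by rewrite rnormZ normc_def/= expr0n addr0 sqrtr_sqr. Qed.

Lemma rdot_rnorm H (x : H) : rdot x x = rnorm x ^+ 2.
Proof. by apply: (@complexI R);
  rewrite rmorphXn /= -rnormE -hdot_normE /rdot -real_complex_ge0// dnorm_ge0. Qed.

Lemma rdotDl H (x y z : H) : rdot (x + y) z = rdot x z + rdot y z.
Proof. by rewrite /rdot linearDl /= raddfD. Qed.
Lemma rdotC H (x y : H) : rdot x y = rdot y x.
Proof. by rewrite /rdot (dotC hdot) /= ; case: (hdot y x). Qed.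
Lemma rdotDr H (x y z : H) : rdot z (x + y) = rdot z x + rdot z y.
Proof. by rewrite rdotC rdotDl !(rdotC z). Qed.
Lemma rdotNl H (x z : H) : rdot (- x) z = - rdot x z.
Proof. by rewrite /rdot linearNl /= raddfN. Qed.
Lemma rdotNr H (x z : H) : rdot z (- x) = - rdot z x.
Proof. by rewrite rdotC rdotNl rdotC. Qed.
Lemma rdotZl H (a : R) (x z : H) : rdot (a%:C%C *: x) z = a * rdot x z.
Proof. by rewrite /rdot dotZl; case: (hdot x z) => u v /=; rewrite mul0r subr0. Qed.

(** Multiplying the second argument by i moves the imaginary part into the real part, so identities
    obtained by real arithmetic on [rdot] carry over to [hdot]. *)
Lemma hdot_rdot H (x y : H) : hdot x y = (rdot x y +i* rdot x ('i%C *: y))%C.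
Proof.
rewrite /rdot dotZr; case: (hdot x y) => u v /=.
by rewrite !(mul0r, mulN1r, mul1r, opprK, sub0r).
Qed.

Lemma rdot_CauchySchwarz H (x y : H) : rdot x y <= rnorm x * rnorm y.
Proof.
have h : `|hdot x y| <= (rnorm x * rnorm y)%:C%C.
  have := dot_CauchySchwarz hdot x y.
  by rewrite !hdot_normE !sqrCK// !rnormE rmorphM.
rewrite -lecR; apply: le_trans h; rewrite /rdot; case: (hdot x y) => u v /=.
rewrite normc_def lecR (le_trans (ler_norm _))//= -sqrtr_sqr ler_wsqrtr//.
by rewrite lerDl sqr_ge0.
Qed.

Lemma invn_le_eps (e : R) : 0 < e -> exists N, forall n, (N <= n)%N -> n.+1%:R^-1 <= e.
Proof.
move=> e0; exists (Num.truncn e^-1) => n Nn.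
rewrite -[leRHS]invrK lef_pV2 ?qualifE/= ?invr_gt0 ?ltr0n//.
have /andP[_ /ltW h] := truncn_itv (ltW (eq_ind _ is_true e0 _ (esym (invr_gt0 e)))).
by apply: le_trans h _; rewrite ler_nat.
Qed.

Lemma le_addeps (x y : R) : (forall e, 0 < e -> x <= y + e) -> x <= y.
Proof. by move=> h; apply/ler_addgt0Pr. Qed.

Lemma rnorm_eq_eps H (x y : H) (M : R) : (forall e, 0 < e -> rnorm (x - y) <= M * e) -> x = y.
Proof.
move=> h; apply/eqP; rewrite -subr_eq0; apply/eqP/rnorm_eq0/eqP.
rewrite eq_le rnorm_ge0 andbT; apply: le_addeps => e e0; rewrite add0r.
have M0 : 0 < `|M| + 1 by rewrite ltr_wpDl.
apply: le_trans (h (e / (`|M| + 1)) (divr_gt0 e0 M0)) _.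
rewrite mulrCA ger_pMr// ler_pdivrMr// mul1r.
by rewrite (le_trans (ler_norm _))// lerDl.
Qed.

(* Completeness without sequences: P e x reads `x approximates the limit up to e'. *)
Lemma complete_rel H (P : R -> H -> Prop) :
  (forall e, 0 < e -> exists x, P e x) ->
  (forall e e' x y, 0 < e -> 0 < e' -> P e x -> P e' y -> rnorm (x - y) <= e + e') ->
  exists l, forall e x, 0 < e -> P e x -> rnorm (x - l) <= e.
Proof.
move=> hex hc.
have p0 n : 0 < n.+1%:R^-1 :> R by rewrite invr_gt0 ltr0n.
have /choice[u uP] : forall n, exists x, P n.+1%:R^-1 x by move=> n; exact: hex.
have [|l hl] := @hilbert_seq_complete _ H u.
  move=> e e0; have er := real_complex_ge0 (ltW e0).
  have s0 : 0 < complex.Re e by rewrite -ltcR -er.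
  pose s := Num.sqrt (complex.Re e).
  have s1 : 0 < s / 2 by rewrite divr_gt0// sqrtr_gt0.
  have [N hN] := invn_le_eps s1; exists N => m n Nm Nn.
  rewrite hdot_normE rnormE -rmorphXn er lecR -(sqr_sqrtr (ltW s0)) -/s.
  rewrite ler_pXn2r ?nnegrE ?rnorm_ge0 ?sqrtr_ge0//.
  have := hc _ _ _ _ (p0 m) (p0 n) (uP m) (uP n).
  have := hN _ Nm; have := hN _ Nn.
  by move=> h1 h2 h3; rewrite (splitr s) (le_trans h3)// lerD.
exists l => e x e0 Px; apply: le_addeps => r r0.
have r2 : 0 < r / 2 by lra.
have [N1 h1] := invn_le_eps r2.
have [|N2 h2] := hl (((r / 2) ^+ 2)%:C%C); first by rewrite ltcR exprn_gt0.
pose n := maxn N1 N2.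
have := h1 n (leq_maxl _ _); have := h2 n (leq_maxr _ _).
rewrite hdot_normE rnormE -rmorphXn lecR ler_pXn2r ?nnegrE ?rnorm_ge0 ?(ltW r2)// => k1 k2.
have := hc _ _ _ _ e0 (p0 n) Px (uP n).
have := rnormD (x - u n) (u n - l); rewrite addrA subrK.
by move: n.+1%:R^-1 k1 k2 => w k1 k2; lra.
Qed.

(* The representing vector minimizes |x|^2 - 2 Re (f x); minimizing vectors form a
   Cauchy family by the parallelogram law. *)
Lemma riesz H (f : H -> R[i]) (M : R) : (forall a x y, f (a *: x + y) = a * f x + f y) ->
  (forall x, complex.Re (f x) <= M * rnorm x) -> exists u, forall x, f x = hdot x u.
Proof.
move=> fl fM.
pose g x := complex.Re (f x).
have gD x y : g (x + y) = g x + g y.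
  by have := fl 1 x y; rewrite scale1r mul1r /g => ->; rewrite raddfD.
have g0 : g 0 = 0 by have := gD 0 0; rewrite addr0; lra.
have gZ (a : R) x : g (a%:C%C *: x) = a * g x.
  have := fl a%:C%C x 0; rewrite addr0 {1}/g => ->.
  rewrite raddfD /= -/(g 0) g0 addr0 /g.
  by case: (f x) => u v /=; rewrite mul0r subr0.
pose J x := rnorm x ^+ 2 - 2 * g x.
have JD x v : J (x + v) = J x + rnorm v ^+ 2 + 2 * (rdot x v - g v).
  rewrite /J -!rdot_rnorm gD !rdotDl !rdotDr (rdotC v x); ring.
have Jlb x : - M ^+ 2 <= J x.
  have := fM x; rewrite -/(g x) /J => h.
  have : 0 <= (rnorm x - M) ^+ 2 by rewrite sqr_ge0.
  by rewrite sqrrB; lra.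
pose S := (range J)%classic.
have hS : has_inf S.
  by split; [exists (J 0), 0|exists (- M ^+ 2) => _ [x _ <-]].
have mJ x : inf S <= J x by apply: (inf_lbound hS.2); exists x.
(* The parallelogram law bounds |x - y|^2 by 2 (J x - inf S) + 2 (J y - inf S); the factor 1/2 turns
   this into e^2 + e'^2 <= (e + e')^2. *)
pose P e x := J x - inf S <= e ^+ 2 / 2.
have [||u hu] := @complete_rel H P.
- move=> e e0; have e2 : 0 < e ^+ 2 / 2 by rewrite divr_gt0 ?exprn_gt0.
  by have [_ [x _ <-] h] := inf_adherent e2 hS; exists x; rewrite /P; lra.
- move=> e e' x y e0 e'0; rewrite /P => hx hy.
  have hm := mJ ((2^-1)%:C%C *: (x + y)).
  have hd : rnorm (x - y) ^+ 2 <= e ^+ 2 + e' ^+ 2.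
    move: hx hy hm; rewrite /J -!rdot_rnorm gZ gD.
    rewrite rdotZl (rdotC (x + y)) rdotZl !rdotDl !rdotDr !rdotNl !rdotNr (rdotC y x).
    set a := rdot x x; set b := rdot x y; set c := rdot y y; set i := inf S.
    by move=> hx hy hm; lra.
  rewrite -(@ler_pXn2r _ 2) ?nnegrE ?rnorm_ge0 ?addr_ge0 ?(ltW e0) ?(ltW e'0)//.
  have : 0 <= e * e' by rewrite mulr_ge0 ?ltW.
  rewrite sqrrD; lra.
(* This is J u <= J (u + v), obtained from near-minimizers x within r of u, so that continuity of J
   is not called for. Replacing u by x costs at most r^2 / 2 + 2 r |v| <= r Y <= e. *)
have key v : 0 <= rnorm v ^+ 2 + 2 * (rdot u v - g v).
  apply: le_addeps => e e0.
  pose Y := 2 * rnorm v + 1.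
  have Y0 : 0 < Y by rewrite /Y; have := rnorm_ge0 v; lra.
  pose r := Num.min 1 (e / Y).
  have r0 : 0 < r by rewrite lt_min ltr01 divr_gt0.
  have r1 : r <= 1 by rewrite ge_min lexx.
  have rY : r * Y <= e by rewrite -ler_pdivlMr// ge_min lexx orbT.
  have [x Px] : exists x, P r x.
    have e2 : 0 < r ^+ 2 / 2 by rewrite divr_gt0 ?exprn_gt0.
    by have [_ [x _ <-] h] := inf_adherent e2 hS; exists x; rewrite /P; lra.
  have h1 := hu _ _ r0 Px; have h2 := mJ (x + v); rewrite JD in h2.
  have := rdot_CauchySchwarz (x - u) v; rewrite rdotDl rdotNl => h3.
  have h4 : rnorm (x - u) * rnorm v <= r * rnorm v by rewrite ler_wpM2r ?rnorm_ge0.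
  have h5 : r ^+ 2 <= r by rewrite expr2 ler_piMr// ltW.
  move: Px rY; rewrite /P /Y mulrDr mulr1 mulrCA => Px rY; lra.
have key2 v : rdot u v = g v.
  have h (t : R) : 0 <= t ^+ 2 * rnorm v ^+ 2 + 2 * t * (rdot u v - g v).
    by have := key (t%:C%C *: v); rewrite gZ (rdotC u) rdotZl rnormZr (rdotC v)
      exprMn real_normK ?num_real//; lra.
  set c := rdot u v - g v in h; suff : c = 0 by rewrite /c; lra.
  (* The quadratic in t is smallest at - c / |v|^2; adding 1 to the denominator spares the case v =
     0 and still makes the value negative unless c = 0. *)
  pose N := rnorm v ^+ 2 + 1; have N0 : 0 < N by rewrite ltr_wpDl ?exprn_ge0 ?rnorm_ge0.
  have := h (- c / N).
  have -> : (- c / N) ^+ 2 * rnorm v ^+ 2 + 2 * (- c / N) * c = - (c / N) ^+ 2 * (N + 1).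
    by rewrite /N; field; rewrite -/N; lra.
  rewrite mulNr oppr_ge0 => h'; apply/eqP.
  have : (c / N) ^+ 2 * (N + 1) == 0.
    by rewrite eq_le h' mulr_ge0 ?sqr_ge0//; lra.
  rewrite mulf_eq0 sqrf_eq0 mulf_eq0 invr_eq0 (gt_eqF N0) orbF => /orP[//|/eqP]; lra.
exists u => x.
have fz a z : f (a *: z) = a * f z.
  have f0 : f 0 = 0 by apply: (@addIr _ (f 0)); have := fl 1 0 0;
    rewrite scale1r add0r mul1r => <-; rewrite add0r.
  by have := fl a z 0; rewrite addr0 f0 addr0.
rewrite hdot_rdot -(rdotC u) key2.
(* The imaginary part of f x is - Re (f (i x)), so agreement of the real parts suffices. *)
have -> : rdot x ('i%C *: u) = - g ('i%C *: x).
  rewrite -key2 (rdotC u) /rdot dotZl dotZr.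
  by case: (hdot x u) => a b /=; rewrite !(mul0r,mul1r,mulN1r,opprK,sub0r).
rewrite /g fz; case: (f x) => a b /=; congr (_ +i* _)%C; rewrite ?mul0r ?mul1r ?sub0r ?opprK//.
Qed.
End RealNorm.

(** * Bounded operators and adjoints *)

Section BoundedOperators.
Variable R : realType.
Implicit Types H K L : hilbertType R.

Lemma hdotDl H (x y z : H) : hdot (x + y) z = hdot x z + hdot y z.
Proof. exact: linearDl. Qed.
Lemma hdotDr H (x y z : H) : hdot z (x + y) = hdot z x + hdot z y.
Proof. exact: linearD. Qed.

Lemma hdot_ext H (x y : H) : (forall z, hdot z x = hdot z y) -> x = y.
Proof.
move=> h; apply/eqP; rewrite -subr_eq0 -(dnorm_eq0 hdot).
by rewrite linearB /= h subrr.
Qed.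

Lemma bopD H K (T : {bop H -> K}) x y : T (x + y) = T x + T y.
Proof. exact: linearD. Qed.
Lemma bopN H K (T : {bop H -> K}) x : T (- x) = - T x.
Proof. exact: linearN. Qed.
Lemma bopB H K (T : {bop H -> K}) x y : T (x - y) = T x - T y.
Proof. exact: linearB. Qed.
Lemma bop_sum H K (T : {bop H -> K}) (I : Type) (s : seq I) (F : I -> H) :
  T (\sum_(i <- s) F i) = \sum_(i <- s) T (F i).
Proof. exact: linear_sum. Qed.
Lemma bop0E H K (T : {bop H -> K}) : T 0 = 0.
Proof. exact: linear0. Qed.

Lemma contractiveP H K (T : {bop H -> K}) :
  contractive_op T <-> forall x, rnorm (T x) <= rnorm x.
Proof. by split=> h x; have := h x; rewrite !rnormE lecR. Qed.

Lemma bop_rnorm H K (T : {bop H -> K}) :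
  exists2 M : R, 0 < M & forall x, rnorm (T x) <= M * rnorm x.
Proof.
have [M M0 h] := bop_bounded T; have Mr := real_complex_ge0 (ltW M0).
exists (complex.Re M); first by rewrite -ltcR -Mr.
by move=> x; have := h x; rewrite !rnormE Mr -rmorphM lecR.
Qed.

Lemma Re_norm_ge0 (z : R[i]) : 0 <= complex.Re `|z|.
Proof. by rewrite normc_def sqrtr_ge0. Qed.

(** A predicate on bare functions: operators are assembled from pointwise formulas and packed only
    at the end, by [bop_of]. *)
Definition bounded_linear H K (f : H -> K) :=
  linear f /\ exists2 M : R, 0 < M & forall x, rnorm (f x) <= M * rnorm x.

Lemma bop_bounded_linear H K (T : {bop H -> K}) : bounded_linear T.
Proof. by split; [exact: linearP|exact: bop_rnorm]. Qed.

Lemma bop_of H K (f : H -> K) : bounded_linear f -> exists T : {bop H -> K}, T =1 f.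
Proof.
move=> [fl [M _ fM]].
have fM' x : `|f x| <= M%:C%C * `|x| by rewrite !rnormE -rmorphM lecR.
by exists (make_bop fl fM').
Qed.

Lemma bounded_linear_eq H K (f g : H -> K) : f =1 g -> bounded_linear f -> bounded_linear g.
Proof. by move=> /funext ->. Qed.

Lemma bounded_linear_comp H K L (f : H -> K) (g : K -> L) :
  bounded_linear f -> bounded_linear g -> bounded_linear (g \o f).
Proof.
move=> [fl [M M0 fM]] [gl [N N0 gN]]; split; first by move=> a x y /=; rewrite fl gl.
exists (N * M); first exact: mulr_gt0.
move=> x /=; apply: le_trans (gN _) _; rewrite -mulrA ler_wpM2l ?fM//; exact: ltW.
Qed.

Lemma bounded_linearD H K (f g : H -> K) :
  bounded_linear f -> bounded_linear g -> bounded_linear (fun x => f x + g x).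
Proof.
move=> [fl [M M0 fM]] [gl [N N0 gN]]; split.
  by move=> a x y /=; rewrite fl gl scalerDr addrACA.
exists (M + N); first exact: addr_gt0.
by move=> x; rewrite mulrDl (le_trans (rnormD _ _))// lerD.
Qed.

Lemma bounded_linearN H K (f : H -> K) :
  bounded_linear f -> bounded_linear (fun x => - f x).
Proof.
move=> [fl [M M0 fM]]; split; last by exists M => // x; rewrite rnormN.
by move=> a x y /=; rewrite fl opprD scalerN.
Qed.

Lemma bounded_linear_sum H K (I : finType) (f : I -> H -> K) :
  (forall i, bounded_linear (f i)) -> bounded_linear (fun x => \sum_i f i x).
Proof.
move=> fb; elim: (index_enum I) => [|i s ih].
  apply: (@bounded_linear_eq _ _ (bop0 H K)); last exact: bop_bounded_linear.
  by move=> x; rewrite big_nil.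
apply: (@bounded_linear_eq _ _ (fun x => f i x + \sum_(j <- s) f j x)).
  by move=> x; rewrite big_cons.
exact: bounded_linearD.
Qed.

Lemma adj_ex H K (T : {bop H -> K}) : exists S : {bop K -> H}, is_adj T S.
Proof.
have [M M0 TM] := bop_rnorm T.
have /choice[S hS] : forall y, exists u, forall x, hdot (T x) y = hdot x u.
  move=> y; apply: (@riesz R H (fun x => hdot (T x) y) (M * rnorm y)).
    by move=> a u v; rewrite linearP linearDl /= dotZl.
  move=> x; apply: le_trans (rdot_CauchySchwarz (T x) y) _.
  by rewrite mulrAC ler_wpM2r ?rnorm_ge0.
have [|T' hT'] := @bop_of K H S; last by exists T' => x y; rewrite hT' hS.
split.
  move=> a x y; apply: hdot_ext => z.
  by rewrite -hS !linearD /= !dotZr !hS.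
(* |S y|^2 = Re <T (S y), y> <= M |S y| |y|, and one factor |S y| cancels. *)
exists M => // y; have [->|y0] := eqVneq (rnorm (S y)) 0.
  by rewrite mulr_ge0 ?rnorm_ge0// ltW.
have Sy : 0 < rnorm (S y) by rewrite lt_def y0 rnorm_ge0.
rewrite -(ler_pM2l Sy) -expr2 -rdot_rnorm /rdot -hS.
apply: le_trans (rdot_CauchySchwarz (T (S y)) y) _.
by rewrite mulrA ler_wpM2r ?rnorm_ge0// mulrC.
Qed.

Lemma adjP H K (T : {bop H -> K}) x y : hdot (T x) y = hdot x (adj T y).
Proof. exact: (xgetPex (bop0 K H) (adj_ex T)). Qed.

Lemma adjP2 H K (T : {bop H -> K}) x y : hdot (adj T x) y = hdot x (T y).
Proof. by rewrite (dotC hdot) -adjP [RHS](dotC hdot). Qed.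

Lemma adj_eq H K (T : {bop H -> K}) y z :
  (forall x, hdot (T x) y = hdot x z) -> adj T y = z.
Proof. by move=> h; apply: hdot_ext => x; rewrite -adjP h. Qed.

Lemma adj_contractive H K (T : {bop H -> K}) : (forall x, rnorm (T x) <= rnorm x) ->
  forall y, rnorm (adj T y) <= rnorm y.
Proof.
move=> h y; have [->|y0] := eqVneq (rnorm (adj T y)) 0; first exact: rnorm_ge0.
have Sy : 0 < rnorm (adj T y) by rewrite lt_def y0 rnorm_ge0.
rewrite -(ler_pM2l Sy) -expr2 -rdot_rnorm /rdot -adjP.
apply: le_trans (rdot_CauchySchwarz _ y) _.
by rewrite ler_wpM2r ?rnorm_ge0.
Qed.

Lemma adj_comp H K L (S : {bop K -> L}) (T : {bop H -> K}) x :
  adj (bop_comp S T) x = adj T (adj S x).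
Proof. by apply: adj_eq => z; rewrite -adjP -adjP. Qed.

Lemma adj_contractive_adj H K (T : {bop H -> K}) : (forall x, rnorm (adj T x) <= rnorm x) ->
  forall y, rnorm (T y) <= rnorm y.
Proof.
move=> h y; have -> : T y = adj (adj T) y by apply: hdot_ext => z; rewrite -adjP adjP2.
exact: adj_contractive.
Qed.

(** Polarization: since <P z, z> is real, z = x + y gives the imaginary part of the identity and z =
    x + i y its real part. *)
Lemma positive_sa H (P : {bop H -> H}) : positive P ->
  forall x y, hdot (P x) y = hdot x (P y).
Proof.
move=> P0 x y.
have ri z : complex.Im (hdot (P z) z) = 0 by rewrite (real_complex_ge0 (P0 z)).
rewrite (dotC hdot x).
have := ri (x + 'i%C *: y); have := ri (x + y); have := ri x; have := ri y.
have E u v : hdot (P (u + v)) (u + v) =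
  hdot (P u) u + hdot (P u) v + (hdot (P v) u + hdot (P v) v).
  by rewrite (linearD P) hdotDl !hdotDr.
have Pi : P ('i%C *: y) = 'i%C *: P y by exact: linearZ.
rewrite !E Pi !dotZl !dotZr.
case: (hdot (P x) x) => ? ?; case: (hdot (P y) y) => ? ?.
case: (hdot (P x) y) => a b; case: (hdot (P y) x) => c e /= -> -> h1 h2.
by congr (_ +i* _)%C; lra.
Qed.

End BoundedOperators.

(** * Square roots and defect operators *)

Section SquareRoot.
Variable R : realType.
Implicit Types H : hilbertType R.

(* root_seq K converges to I - (I - K)^(1/2); root_scal is its value on the scalar
   K = 1 and majorizes it, in that |Y_(n+1) - Y_n| <= a_(n+1) - a_n. *)
Fixpoint root_scal n : R := if n is m.+1 then (1 + root_scal m ^+ 2) / 2 else 0.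

Lemma root_scal_itv n : 0 <= root_scal n <= 1.
Proof. elim: n => [|n /andP[h0 h1]] /=; first by rewrite lexx ler01. apply/andP; split;
  nra. Qed.

(** The error c_n = 1 - [root_scal n] satisfies c_(n+1) = c_n - c_n^2 / 2. As w - w^2 / 2 increases
    on [0, 1], the bound c_n <= 2 / (n + 2) is inherited by the next step. *)
Lemma root_scal_cvg n : 1 - root_scal n <= 2 * n.+1%:R^-1.
Proof.
suff h : (1 - root_scal n) * (n%:R + 2) <= 2.
  have n1 : 0 < n.+1%:R :> R by rewrite ltr0n.
  rewrite ler_pdivlMr//; apply: le_trans h.
  have /andP[h0 h1] := root_scal_itv n.
  by rewrite ler_wpM2l ?subr_ge0// -natr1 lerD2l ler1n.
elim: n => [|n ih] /=; first lra.
have /andP[h0 h1] := root_scal_itv n.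
have t0 : 0 < n%:R + 2 :> R by rewrite ltr_wpDl.
have t2 : 2 <= n%:R + 2 :> R by rewrite lerDr.
have -> : n.+1%:R + 2 = n%:R + 2 + 1 :> R by rewrite -natr1 addrAC.
move: ih; rewrite -ler_pdivlMr//.
move: (n%:R + 2) t0 t2 h0 h1 => t t0 t2.
set w := 2 / t; have wt : w * t = 2 by rewrite /w divfK ?gt_eqF.
have w0 : 0 <= w by rewrite divr_ge0// ltW.
have w1 : w <= 1 by rewrite ler_pdivrMr// mul1r.
move: (root_scal n) => b b0 b1 bw.
have h : 1 - (1 + b ^+ 2) / 2 <= w - w ^+ 2 / 2.
  have : 0 <= (w - (1 - b)) * (1 - (w + (1 - b)) / 2) by rewrite mulr_ge0 ?subr_ge0//; lra.
  move=> h; lra.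
apply: (@le_trans _ _ ((w - w ^+ 2 / 2) * (t + 1))); first by rewrite ler_wpM2r//; lra.
have -> : (w - w ^+ 2 / 2) * (t + 1) = w * t + w - w ^+ 2 / 2 - w * (w * t) / 2 by field.
rewrite wt; have : 0 <= w ^+ 2 by rewrite sqr_ge0.
lra.
Qed.

(** With S = I - Y, the equation S^2 = I - K becomes Y = (K + Y^2) / 2; this is its fixed point
    iteration started at 0. *)
Fixpoint root_seq H (K : H -> H) n x : H :=
  if n is m.+1 then (2^-1 : R)%:C%C *: (K x + root_seq K m (root_seq K m x)) else 0.

Lemma root_scal_eq H (x y : H) (M : R) : 0 <= M ->
  (forall n, rnorm (x - y) <= M * (1 - root_scal n)) -> x = y.
Proof.
move=> M0 h; apply: (@rnorm_eq_eps _ _ _ _ (2 * M)) => e e0; have [N hN] := invn_le_eps e0.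
apply: le_trans (h N) _; rewrite (mulrC 2) -mulrA ler_wpM2l//.
by apply: le_trans (root_scal_cvg N) _; rewrite ler_pM2l ?hN.
Qed.

Section Root.
Variables (H : hilbertType R) (K : {bop H -> H}).
Hypothesis Kc : forall x, rnorm (K x) <= rnorm x.
Hypothesis Ks : forall x y, hdot (K x) y = hdot x (K y).
Let Y := root_seq K.
Let a := root_scal.

Lemma root_seqS n x : Y n.+1 x = (2^-1 : R)%:C%C *: (K x + Y n (Y n x)).
Proof. by []. Qed.
Lemma root_scalS n : a n.+1 = (1 + a n ^+ 2) / 2.
Proof. by []. Qed.
Lemma root_scal_le n : a n <= a n.+1.
Proof.
have : 0 <= (1 - a n) ^+ 2 by rewrite sqr_ge0.
by rewrite root_scalS; lra.
Qed.

Lemma root_seq_linear n : linear (Y n).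
Proof.
elim: n => [|n ih] z x y; first by rewrite /= scaler0 addr0.
rewrite !root_seqS !ih linearP.
by rewrite addrACA -(scalerDr z) (scalerDr (2^-1)%:C%C) !scalerA (mulrC z).
Qed.

Lemma root_seqB n x y : Y n (x - y) = Y n x - Y n y.
Proof.
by have := root_seq_linear n (-1) y x; rewrite !scaleN1r (addrC _ x) (addrC _ (Y n x)).
Qed.

Lemma rnorm_half (x : H) : rnorm ((2^-1 : R)%:C%C *: x) = rnorm x / 2.
Proof. by rewrite rnormZr ger0_norm ?invr_ge0// mulrC. Qed.

Lemma root_seq_bound n x : rnorm (Y n x) <= a n * rnorm x.
Proof.
elim: n x => [|n ih] x; first by rewrite /= rnorm0 mul0r.
rewrite root_seqS root_scalS rnorm_half.
have /andP[a0 a1] := root_scal_itv n.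
have := rnormD (K x) (Y n (Y n x)); have := Kc x; have := ih (Y n x).
have : a n * rnorm (Y n x) <= a n * (a n * rnorm x) by rewrite ler_wpM2l ?ih.
move: (rnorm (Y n (Y n x))) => u1 u2 u3 u4 u5; lra.
Qed.

(** Y' Y' - Y Y = Y' (Y' - Y) + (Y' - Y) Y holds without commutation, and on the scalar side the
    same splitting of a'^2 - a^2 is exact. So the induction closes with the majorant unchanged. *)
Lemma root_seq_step n x : rnorm (Y n.+1 x - Y n x) <= (a n.+1 - a n) * rnorm x.
Proof.
elim: n x => [|n ih] x.
  have := root_seq_bound 1 x; rewrite [Y 0 x]/= subr0 [a 0]/= subr0; exact.
have -> : Y n.+2 x - Y n.+1 x = (2^-1 : R)%:C%C *:
    (Y n.+1 (Y n.+1 x - Y n x) + (Y n.+1 (Y n x) - Y n (Y n x))).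
  rewrite (root_seqS n.+1) [in X in _ - X](root_seqS n) -scalerBr root_seqB subrKA;
    congr (_ *: _).
  by rewrite opprD addrACA subrr add0r.
rewrite rnorm_half ler_pdivrMr// (le_trans (rnormD _ _))//.
have := root_seq_bound n.+1 (Y n.+1 x - Y n x); have := ih x; have := ih (Y n x).
have /andP[a0 a1] := root_scal_itv n.
have /andP[b0 b1] := root_scal_itv n.+1.
rewrite -/(a n) in a0 a1; rewrite -/(a n.+1) in b0 b1.
have ab : 0 <= a n.+1 - a n.
  by rewrite subr_ge0 root_scal_le.
have : a n.+1 * rnorm (Y n.+1 x - Y n x) <= a n.+1 * ((a n.+1 - a n) * rnorm x).
  by rewrite ler_wpM2l ?ih.
have : (a n.+1 - a n) * rnorm (Y n x) <= (a n.+1 - a n) * (a n * rnorm x).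
  by rewrite ler_wpM2l ?root_seq_bound.
have -> : (a n.+2 - a n.+1) * rnorm x * 2 = (a n.+1 ^+ 2 - a n ^+ 2) * rnorm x.
  by rewrite [a n.+2]root_scalS {2}[a n.+1]root_scalS; field.
move: (rnorm (Y n.+1 _)) (rnorm (_ - Y n (Y n x))) (rnorm (Y n x)) (rnorm (Y n.+1 x - Y n x))
  (rnorm x) (a n) (a n.+1).
move=> u1 u2 u3 u4 u5 u6 u7 *; lra.
Qed.

Lemma root_seq_cauchy n m x : (n <= m)%N -> rnorm (Y m x - Y n x) <= (a m - a n) * rnorm x.
Proof.
move=> /subnK <-; elim: (m - n)%N => [|k ih]; first by rewrite add0n !subrr rnorm0 mul0r.
rewrite addSn -(subrK (Y (k + n) x) (Y _.+1 x)) -addrA (le_trans (rnormD _ _))//.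
by have := root_seq_step (k + n) x; lra.
Qed.

(** The majorant increases to 1, so 1 - [a n] dominates all its later increments; it serves as the
    tolerance of the n-th approximant in [complete_rel]. *)
Lemma root_seq_lim x : exists y, forall n, rnorm (Y n x - y) <= (1 - a n) * rnorm x.
Proof.
have dn n : 0 <= (1 - a n) * rnorm x.
  by have /andP[? ?] := root_scal_itv n; rewrite mulr_ge0 ?rnorm_ge0 ?subr_ge0.
have [||y hy] := @complete_rel R H (fun e z => exists2 n, z = Y n x & (1 - a n) * rnorm x <= e).
- move=> e e0; have r0 : 0 < e / (2 * (rnorm x + 1)).
    by rewrite divr_gt0 ?mulr_gt0 ?ltr_wpDl ?rnorm_ge0.
  have [N /(_ N (leqnn _)) hN] := invn_le_eps r0; exists (Y N x); exists N => //.
  have := root_scal_cvg N; have := rnorm_ge0 x.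
  move: hN; rewrite ler_pdivlMr; last by rewrite mulr_gt0 ?ltr_wpDl ?rnorm_ge0.
  move: (dn N); rewrite -/(a N); move: (a N) (rnorm x) => u v h1 h2 h3 h4.
  have i0 : 0 <= N.+1%:R^-1 :> R by rewrite invr_ge0.
  have : (1 - u) * v <= 2 * N.+1%:R^-1 * v by rewrite ler_wpM2r.
  move: N.+1%:R^-1 h2 i0 {h4} => w h2 i0 h4; lra.
- move=> e e' _ _ e0 e'0 [n -> hn] [m -> hm].
  have [nm|mn] := leqP n m.
    by have := root_seq_cauchy x nm; rewrite rnormB; have := dn m; lra.
  by have := root_seq_cauchy x (ltnW mn); have := dn n; lra.
exists y => n; apply: le_addeps => e e0; apply: hy; first exact: ltr_wpDl.
by exists n => //; rewrite lerDl ltW.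
Qed.

(** The rate is kept in the conclusion because intertwining relations reach the root only through
    its approximants. *)
Lemma root_ex : exists S : {bop H -> H},
  [/\ is_sqrt (fun x => x - K x) S &
      forall n x, rnorm (x - S x - Y n x) <= (1 - a n) * rnorm x].
Proof.
have /choice[Z hZ] := root_seq_lim.
have hZ' n x : rnorm (Z x - Y n x) <= (1 - a n) * rnorm x by rewrite rnormB.
have Zl : linear Z.
  move=> z x y; apply: (@root_scal_eq _ _ _ (rnorm (z *:
    x + y) + complex.Re `|z| * rnorm x + rnorm y)).
    rewrite !addr_ge0 ?mulr_ge0 ?rnorm_ge0//; exact: Re_norm_ge0.
  move=> n.
  have -> : Z (z *: x + y) - (z *: Z x + Z y) =
      (Z (z *: x + y) - Y n (z *: x + y)) + (z *: (Y n x - Z x) + (Y n y - Z y)).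
    rewrite root_seq_linear scalerBr (addrACA (z *: Y n x)) -opprD subrKA; by [].
  apply: le_trans (rnormD _ _) _; rewrite mulrC -addrA mulrDr lerD//.
  apply: le_trans (rnormD _ _) _; rewrite mulrDr lerD// rnormZ mulrCA ler_wpM2l//.
  exact: Re_norm_ge0.
have Zc x : rnorm (Z x) <= rnorm x.
  have h : rnorm (Z x) <= (1 - a 0) * rnorm x by have := hZ' 0%N x; rewrite [Y _ _]/= subr0.
  by move: h; rewrite [a 0]/= subr0 mul1r.
(* The limit of 2 Y_(n+1) = K + Y_n Y_n. The difference is split into four errors, each at most (1 -
   a n) |x|. *)
have ZZ x : Z x + Z x = K x + Z (Z x).
  apply: (@root_scal_eq _ _ _ (4 * rnorm x)); first by rewrite mulr_ge0 ?rnorm_ge0.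
  move=> n.
  have e1 : Y n.+1 x + Y n.+1 x = K x + Y n (Y n x).
    rewrite root_seqS -scalerDl -rmorphD (_ : 2^-1 + 2^-1 = 1) ?scale1r//; lra.
  have -> : Z x + Z x - (K x + Z (Z x)) = (Z x - Y n.+1 x) + ((Z x - Y n.+1 x) +
      (Y n (Y n x - Z x) + (Y n (Z x) - Z (Z x)))).
    rewrite root_seqB subrKA addrA (addrACA (Z x)) -opprD e1.
    by rewrite !opprD !addrA subrK.
  have := rnormD (Z x - Y n.+1 x) ((Z x - Y n.+1 x) +
      (Y n (Y n x - Z x) + (Y n (Z x) - Z (Z x)))).
  have := rnormD (Z x - Y n.+1 x) (Y n (Y n x - Z x) + (Y n (Z x) - Z (Z x))).
  have := rnormD (Y n (Y n x - Z x)) (Y n (Z x) - Z (Z x)).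
  have := hZ' n.+1 x; have := root_seq_bound n (Y n x - Z x); have := hZ x n.
  have := hZ (Z x) n; have := Zc x.
  have /andP[a0 a1] := root_scal_itv n; rewrite -/(a n) in a0 a1.
  have aa := root_scal_le n.
  rewrite -/(a n).
  move: (rnorm_ge0 (Y n x - Z x)) (rnorm_ge0 x) (rnorm_ge0 (Z x)).
  move: (rnorm (Y n (Y n x - Z x) + _)) (rnorm (Y n (Y n x - Z x))) (rnorm (Y n x - Z x))
    => u1 u2 u3.
  move: (rnorm (Y n (Z x) - _)) (rnorm (Z x - Y n.+1 x + (Z x - _ + _))) => u4 u5.
  move: (rnorm (Z x - Y n.+1 x + _)) (rnorm (Z x - Y n.+1 x)) => u6 u7.
  move: (rnorm x) (rnorm (Z x)) (a n) (a n.+1) a0 a1 aa => v1 v2 b b' b0 b1 bb *.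
  have : b * u3 <= u3 by rewrite ler_piMl.
  have : (1 - b) * v2 <= (1 - b) * v1 by rewrite ler_wpM2l// subr_ge0.
  have : (1 - b') * v1 <= (1 - b) * v1 by rewrite ler_wpM2r// lerB.
  lra.
(* Each approximant is symmetric; by exchanging the roles of x and y, one inequality with an error
   tending to 0 is enough. *)
have Zs x y : rdot (Z x) y = rdot x (Z y).
  have Yh n u v : hdot (Y n u) v = hdot u (Y n v).
    elim: n u v => [|n ih] u v; first by rewrite linear0l linear0r.
    rewrite [Y _]/= -/(Y n) dotZl dotZr linearDl linearD /= Ks !ih.
    by congr (_ * _); apply/esym/geC0_conj; rewrite ler0c invr_ge0.
  have Yr n u v : rdot (Y n u) v = rdot u (Y n v) by rewrite /rdot Yh.
  have key u v : rdot (Z u) v <= rdot u (Z v).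
    apply: le_addeps => e e0.
    have r0 : 0 < e / (4 * (rnorm u * rnorm v + 1)).
      by rewrite divr_gt0 ?mulr_gt0 ?ltr_wpDl ?mulr_ge0 ?rnorm_ge0.
    have [n /(_ n (leqnn _)) hn] := invn_le_eps r0.
    have := root_scal_cvg n; rewrite -/(a n).
    move: hn; rewrite ler_pdivlMr; last by rewrite mulr_gt0 ?ltr_wpDl ?mulr_ge0 ?rnorm_ge0.
    have := rdot_CauchySchwarz (Z u - Y n u) v; have := rdot_CauchySchwarz u (Y n v - Z v).
    have : rnorm (Z u - Y n u) * rnorm v <= (1 - a n)
      * rnorm u * rnorm v by rewrite ler_wpM2r ?rnorm_ge0.
    have : rnorm u * rnorm (Y n v - Z v) <= rnorm u * ((1 - a n) * rnorm v)
      by rewrite ler_wpM2l ?rnorm_ge0.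
    rewrite rdotDl rdotDr rdotNl rdotNr Yr => h1 h2 h3 h4 h5 h6.
    have i0 : 0 <= n.+1%:R^-1 :> R by rewrite invr_ge0.
    have : (1 - a n) * (rnorm u * rnorm v) <= 2 * n.+1%:R^-1 * (rnorm u * rnorm v).
      by rewrite ler_wpM2r ?mulr_ge0 ?rnorm_ge0.
    move: n.+1%:R^-1 h5 i0 {h6} => w h5 i0 h6; lra.
  apply/eqP; rewrite eq_le key /= (rdotC x) (rdotC (Z x)); exact: key.
have [|S hS] := @bop_of R H H (fun x => x - Z x).
  apply: bounded_linearD; first exact: (bop_bounded_linear (bop_id H)).
  by apply: bounded_linearN; split=> //; exists 1 => // x; rewrite mul1r.
exists S; split; last by move=> n x; rewrite hS opprB (addrCA x) subrr addr0.
split.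
  (* Positivity includes reality of <S x, x>: its imaginary part vanishes because Z is symmetric and
     commutes with i. The real part is nonnegative because Z is contractive. *)
  move=> x; rewrite hS hdot_rdot rdotDl rdotNl.
  have -> : rdot (x - Z x) ('i%C *: x) = 0.
    have ZI : Z ('i%C *: x) = 'i%C *: Z x.
      have Z0 : Z 0 = 0 by apply/rnorm_eq0/eqP; rewrite eq_le rnorm_ge0 andbT; have := Zc 0;
        rewrite rnorm0.
      by have := Zl 'i%C x 0; rewrite !addr0 Z0 addr0.
    have h (u v : H) : rdot u ('i%C *: v) = - rdot ('i%C *: u) v.
      by rewrite /rdot dotZl dotZr; case: (hdot u v) => p q /=;
        rewrite !(mul0r,mul1r,mulN1r,opprK,sub0r).
    have h0 (u : H) : rdot u ('i%C *: u) = 0 by have := h u u; rewrite (rdotC ('i%C *: u)); lra.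
    rewrite rdotDl rdotNl h0 sub0r.
    have := h (Z x) x; rewrite -ZI Zs (rdotC x) ZI.
    rewrite (rdotC ('i%C *: Z x)); lra.
  rewrite lecE /= eqxx /= rdot_rnorm.
  have := rdot_CauchySchwarz (Z x) x; have := Zc x; have := rnorm_ge0 x.
  move: (rnorm x) (rnorm (Z x)) => u v u0 vu h.
  have : v * u <= u * u by rewrite ler_wpM2r.
  by rewrite -expr2; lra.
move=> x; rewrite !hS.
have ZB u v : Z (u - v) = Z u - Z v.
  by have := Zl (-1) v u; rewrite !scaleN1r (addrC _ u) (addrC _ (Z u)).
have -> : K x = Z x + Z x - Z (Z x) by rewrite ZZ addrK.
by rewrite ZB !opprD !opprK !addrA.
Qed.

End Root.
End SquareRoot.

(** * Intertwining, uniqueness of positive roots, and defect operators *)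

Section Defect.
Variable R : realType.
Implicit Types H K : hilbertType R.

Lemma root_seq_intertwine H1 H2 (K1 : {bop H1 -> H1}) (K2 : {bop H2 -> H2}) (T : {bop H1 ->
  H2}) :
  (forall x, K2 (T x) = T (K1 x)) ->
  forall n x, root_seq K2 n (T x) = T (root_seq K1 n x).
Proof.
move=> h; elim=> [|n ih] x /=; first by rewrite linear0.
by rewrite h !ih -linearD [RHS]linearZ.
Qed.

(** T intertwines the approximants exactly, so T x - S2 (T x) and T (x - S1 x) are both within a
    multiple of 1 - [root_scal n] of the same vector. *)
Lemma root_limit_intertwine H1 H2 (K1 : {bop H1 -> H1}) (K2 : {bop H2 -> H2}) (T : {bop H1 ->
  H2})
    (S1 : {bop H1 -> H1}) (S2 : {bop H2 -> H2}) :
  (forall n x, rnorm (x - S1 x - root_seq K1 n x) <= (1 - root_scal R n) * rnorm x) ->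
  (forall n x, rnorm (x - S2 x - root_seq K2 n x) <= (1 - root_scal R n) * rnorm x) ->
  (forall x, K2 (T x) = T (K1 x)) -> forall x, S2 (T x) = T (S1 x).
Proof.
move=> h1 h2 KT x.
have [M M0 TM] := bop_rnorm T.
suff : T x - S2 (T x) = T (x - S1 x) by rewrite linearB => /addrI/oppr_inj.
apply: (@root_scal_eq _ _ _ _ (rnorm (T x) + M * rnorm x)).
  by rewrite addr_ge0 ?mulr_ge0 ?rnorm_ge0// ltW.
move=> n; rewrite -(subrK (root_seq K2 n (T x)) (T x - S2 (T x))) -addrA.
apply: le_trans (rnormD _ _) _.
rewrite mulrC mulrDr lerD//.
rewrite (root_seq_intertwine KT) -(linearB T).
apply: le_trans (TM _) _; rewrite mulrCA ler_wpM2l ?(ltW M0)// rnormB; exact: h1.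
Qed.

(** Positivity at y + t T y gives 2 t |T y|^2 + t^2 c >= 0 for all real t, with no constant term,
    which forces |T y| = 0. The 1 in t = - |T y|^2 / (c + 1) covers c = 0. *)
Lemma positive_ker H (T : {bop H -> H}) y : positive T -> hdot (T y) y = 0 -> T y = 0.
Proof.
move=> T0 Ty; apply: rnorm_eq0.
have Ts := positive_sa T0.
have q (t : R) : 0 <= 2 * t * rnorm (T y) ^+ 2 + t ^+ 2 * rdot (T (T y)) (T y).
  have TE : T (y + t%:C%C *: T y) = T y + t%:C%C *: T (T y) by rewrite linearD linearZ.
  have : 0 <= rdot (T (y + t%:C%C *: T y)) (y + t%:C%C *: T y).
    by have := T0 (y + t%:C%C *: T y); rewrite lecE => /andP[_].
  rewrite TE rdotDl !rdotDr !rdotZl (rdotC _ (t%:C%C *: T y)) (rdotC (T (T y)) (t%:C%C *: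
    T y)) !rdotZl.
  have -> : rdot (T y) y = 0 by rewrite /rdot Ty.
  have -> : rdot (T (T y)) y = rdot (T y) (T y) by rewrite /rdot Ts.
  by rewrite rdot_rnorm (rdotC (T y) (T (T y))); lra.
have c0 : 0 <= rdot (T (T y)) (T y).
  by have := T0 (T y); rewrite lecE => /andP[_].
move: q c0 (rnorm_ge0 (T y)); move: (rnorm _) (rdot _ _) => r c q c0 r0.
have c1 : 0 < c + 1 by lra.
have := q (- (r ^+ 2 / (c + 1))).
have -> : 2 * - (r ^+ 2 / (c + 1)) * r ^+ 2 + (- (r ^+ 2 / (c + 1))) ^+ 2 * c =
   - ((r ^+ 2 / (c + 1)) ^+ 2 * (c + 2)) by field; rewrite gt_eqF.
rewrite oppr_ge0 => h.
have : (r ^+ 2 / (c + 1)) ^+ 2 * (c + 2) == 0.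
  by rewrite eq_le h mulr_ge0 ?sqr_ge0//; lra.
rewrite mulf_eq0 sqrf_eq0 mulf_eq0 invr_eq0 sqrf_eq0 (gt_eqF c1) orbF.
by move=> /orP[/eqP//|/eqP]; lra.
Qed.

(* For y = (S - D) x, commutation gives (S + D) y = 0, whence S y = D y = 0. *)
Lemma is_sqrt_unique H (P : H -> H) (S D : {bop H -> H}) : is_sqrt P S -> is_sqrt P D ->
  (forall x, S (D x) = D (S x)) -> S =1 D.
Proof.
move=> [S0 SS] [D0 DD] SD x.
pose y := S x - D x.
have SDy : S y + D y = 0.
  by rewrite /y (linearB S) (linearB D) /= SS DD SD addrA subrK subrr.
have : hdot (S y) y + hdot (D y) y = 0 by rewrite -hdotDl SDy linear0l.
move=> /eqP; rewrite paddr_eq0// => /andP[/eqP/(positive_ker S0) Sy /eqP/(positive_ker D0) Dy].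
apply/eqP; rewrite -subr_eq0 -/y -(dnorm_eq0 hdot) {1}/y linearBl /=.
by rewrite (positive_sa S0) (positive_sa D0) Sy Dy !linear0r subrr.
Qed.

(** D commutes with K = I - D^2, hence with the root S built by iteration; uniqueness among
    commuting positive roots then gives S = D. In this way the rate becomes available for a root
    picked by choice. *)
Lemma is_sqrt_approx H (K D : {bop H -> H}) : (forall x, rnorm (K x) <= rnorm x) ->
  (forall x y, hdot (K x) y = hdot x (K y)) -> is_sqrt (fun x => x - K x) D ->
  forall n x, rnorm (x - D x - root_seq K n x) <= (1 - root_scal R n) * rnorm x.
Proof.
move=> Kc Ks hD; have [S [hS Sa]] := root_ex Kc Ks.
suff SD : S =1 D by move=> n x; rewrite -SD.
apply: (is_sqrt_unique hS hD).
apply: (@root_limit_intertwine _ _ K K D S S) => // x.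
have h z : K z = z - D (D z) by rewrite hD.2 opprB addrCA subrr addr0.
by rewrite !h linearB.
Qed.

Lemma sqrt_intertwine H1 H2 (K1 : {bop H1 -> H1}) (K2 : {bop H2 -> H2}) (T : {bop H1 -> H2})
    (D1 : {bop H1 -> H1}) (D2 : {bop H2 -> H2}) :
  (forall x, rnorm (K1 x) <= rnorm x) -> (forall x y, hdot (K1 x) y = hdot x (K1 y)) ->
  (forall x, rnorm (K2 x) <= rnorm x) -> (forall x y, hdot (K2 x) y = hdot x (K2 y)) ->
  is_sqrt (fun x => x - K1 x) D1 -> is_sqrt (fun x => x - K2 x) D2 ->
  (forall x, K2 (T x) = T (K1 x)) -> forall x, D2 (T x) = T (D1 x).
Proof.
move=> c1 s1 c2 s2 h1 h2 KT.
by apply: root_limit_intertwine KT; apply: is_sqrt_approx.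
Qed.

Section Contraction.
Variables (H K : hilbertType R) (T : {bop H -> K}).
Hypothesis Tc : forall x, rnorm (T x) <= rnorm x.

Let TT := bop_comp (adj T) T.
Let TT' := bop_comp T (adj T).

Let TTc x : rnorm (TT x) <= rnorm x.
Proof. exact: le_trans (adj_contractive Tc _) (Tc _). Qed.
Let TTc' x : rnorm (TT' x) <= rnorm x.
Proof. exact: le_trans (Tc _) (adj_contractive Tc _). Qed.
Let TTs x y : hdot (TT x) y = hdot x (TT y).
Proof. by rewrite /= adjP2 -adjP. Qed.
Let TTs' x y : hdot (TT' x) y = hdot x (TT' y).
Proof. by rewrite /= adjP adjP2. Qed.

Lemma defect_sqrt : is_sqrt (fun x => x - adj T (T x)) (defect T).
Proof.
have [S [hS _]] := root_ex TTc TTs.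
exact: (xgetPex (bop0 H H) (ex_intro [set D | is_sqrt _ D]%classic S hS)).
Qed.

Lemma defect_star_sqrt : is_sqrt (fun x => x - T (adj T x)) (defect_star T).
Proof.
have [S [hS _]] := root_ex TTc' TTs'.
exact: (xgetPex (bop0 K K) (ex_intro [set D | is_sqrt _ D]%classic S hS)).
Qed.

Lemma defect_sa x y : hdot (defect T x) y = hdot x (defect T y).
Proof. exact: positive_sa defect_sqrt.1 _ _. Qed.

Lemma defect_star_sa x y : hdot (defect_star T x) y = hdot x (defect_star T y).
Proof. exact: positive_sa defect_star_sqrt.1 _ _. Qed.

Lemma defect2 x : defect T (defect T x) = x - adj T (T x).
Proof. exact: defect_sqrt.2. Qed.

Lemma defect_star2 x : defect_star T (defect_star T x) = x - T (adj T x).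
Proof. exact: defect_star_sqrt.2. Qed.

Lemma defect_intertwine x : defect_star T (T x) = T (defect T x).
Proof.
by apply: (@sqrt_intertwine _ _ TT TT' T) => //; [exact: defect_sqrt|exact: defect_star_sqrt].
Qed.

Lemma adj_defect_intertwine x : defect T (adj T x) = adj T (defect_star T x).
Proof.
by apply: (@sqrt_intertwine _ _ TT' TT (adj T)) => //; [exact: defect_star_sqrt|exact:
  defect_sqrt].
Qed.

Lemma defect_norm x : rnorm (defect T x) ^+ 2 = rnorm x ^+ 2 - rnorm (T x) ^+ 2.
Proof.
by rewrite -!rdot_rnorm /rdot defect_sa defect2 linearB /= -adjP raddfB.
Qed.

Lemma defect_star_norm x : rnorm (defect_star T x) ^+ 2 = rnorm x ^+ 2 - rnorm (adj T x) ^+ 2.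
Proof.
by rewrite -!rdot_rnorm /rdot defect_star_sa defect_star2 linearB /= -adjP2 raddfB.
Qed.

End Contraction.

Section RanClosure.
Variables (H K : hilbertType R).

Lemma ran_closureP (T : {bop H -> K}) y :
  (y \in hsub_pred (ran_closure T)) <-> forall e, 0 < e -> exists x, rnorm (y - T x) <= e.
Proof.
rewrite inE; split=> [/closureNP h e e0|h].
  have [|_ [x _ <-]] := h e%:C%C; first by rewrite ltcR.
  by rewrite rnormE lecR; exists x.
apply/closureNP => e e0; have er := real_complex_ge0 (ltW e0).
have [|x hx] := h (complex.Re e); first by rewrite -ltcR -er.
by exists (T x); [exists x|rewrite rnormE er lecR].
Qed.

Lemma ran_closure_mem (T : {bop H -> K}) x : T x \in hsub_pred (ran_closure T).
Proof. by apply/ran_closureP => e e0; exists x; rewrite subrr rnorm0 ltW. Qed.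

Lemma hsubD (S : hsubspace K) (x y : S) :
  hsub_val (x + y) = hsub_val x + hsub_val y.
Proof. by []. Qed.
Lemma hsubB (S : hsubspace K) (x y : S) :
  hsub_val (x - y) = hsub_val x - hsub_val y.
Proof. by []. Qed.
Lemma hdot_hsub (S : hsubspace K) (x y : S) :
  hdot (hsub_val x) (hsub_val y) = hdot x y.
Proof. by []. Qed.

Lemma corestrK (S : hsubspace K) x : x \in hsub_pred S -> hsub_val (corestr x : S) = x.
Proof. by move=> xS; rewrite /corestr /insubd insubT. Qed.

Lemma hsub_inj (S : hsubspace K) (x y : S) : hsub_val x = hsub_val y -> x = y.
Proof. exact: val_inj. Qed.

Lemma rnorm_hsub (S : hsubspace K) (x : S) : rnorm (hsub_val x) = rnorm x.
Proof.
apply/eqP; rewrite -(@eqrXn2 _ 2) ?rnorm_ge0//; by rewrite -!rdot_rnorm.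
Qed.

Lemma hsub_val_blin (S : hsubspace K) : bounded_linear (hsub_val : S -> K).
Proof. by split=> //; exists 1 => // x; rewrite rnorm_hsub mul1r. Qed.

Lemma corestr_blin (S : hsubspace K) (f : H -> K) : (forall x, f x \in hsub_pred S) ->
  bounded_linear f -> bounded_linear (fun x => corestr (f x) : S).
Proof.
move=> fS [fl [M M0 fM]]; split.
  by move=> a x y; apply: hsub_inj; rewrite /= !corestrK// fl.
by exists M => // x; rewrite -rnorm_hsub corestrK.
Qed.

End RanClosure.

Lemma map_ran_closure H K H' K' (T : {bop H -> K}) (T' : {bop H' -> K'}) (f : {bop K -> K'}) :
  (forall x, f (T x) \in hsub_pred (ran_closure T')) ->
  forall y, y \in hsub_pred (ran_closure T) -> f y \in hsub_pred (ran_closure T').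
Proof.
move=> h y /ran_closureP hy; apply/ran_closureP => e e0.
have [M M0 fM] := bop_rnorm f.
have e2 : 0 < e / 2 by rewrite divr_gt0.
have [x hx] := hy (e / 2 / M) (divr_gt0 e2 M0).
have /ran_closureP/(_ _ e2)[z hz] := h x.
exists z; rewrite -(subrK (f (T x)) (f y)) -addrA (le_trans (rnormD _ _))// (splitr e) lerD//.
rewrite -linearB (le_trans (fM _))// mulrC -ler_pdivlMr//.
Qed.

End Defect.

(** * Extension of isometries *)

Section UnitaryExtension.
Variable R : realType.
Implicit Types H K : hilbertType R.

Definition dense_range H K (T : {bop H -> K}) :=
  forall y e, 0 < e -> exists x, rnorm (T x - y) <= e.

(** The closure of the relation D x |-> L x. It is symmetric in D and L, and no preimage under D has
    to be selected. *)
Definition graph_closure H K1 K2 (D : {bop H -> K1}) (L : {bop H -> K2}) y z :=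
  forall e, 0 < e -> exists x, rnorm (D x - y) <= e /\ rnorm (L x - z) <= e.

Lemma graph_closure_total H K1 K2 (D : {bop H -> K1}) (L : {bop H -> K2}) :
  dense_range D -> (forall x, rnorm (D x) = rnorm (L x)) ->
  forall y, exists z, graph_closure D L y z.
Proof.
move=> Dd DL y.
have [||z hz] := @complete_rel R K2 (fun e z => exists2 x, z = L x & rnorm (D x - y) <= e).
- by move=> e /(Dd y)[x hx]; exists (L x), x.
- move=> e e' _ _ e0 e'0 [x -> hx] [x' -> hx'].
  rewrite -linearB -DL linearB /= -(subrKA y).
  by apply: le_trans (rnormD _ _) _; rewrite lerD// rnormB.
exists z => e e0; have [x hx] := Dd y e e0; exists x; split=> //.
by apply: hz => //; exists x.
Qed.

Lemma polarization H (x y : H) : rdot x y = (rnorm (x + y)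
  ^+ 2 - rnorm x ^+ 2 - rnorm y ^+ 2) / 2.
Proof. by rewrite -!rdot_rnorm rdotDl !rdotDr (rdotC y x); field. Qed.

Lemma isometry_hdot H K (T : {bop H -> K}) : (forall x, rnorm (T x) = rnorm x) ->
  forall x y, hdot (T x) (T y) = hdot x y.
Proof.
move=> Ti x y.
have Tr u v : rdot (T u) (T v) = rdot u v by rewrite !polarization -linearD !Ti.
rewrite !hdot_rdot Tr; congr (_ +i* _)%C.
by rewrite -Tr; congr rdot; rewrite linearZ.
Qed.

(** The closed graph is linear and preserves norms, hence single-valued: (0, z' - z) in it forces z
    = z'. Being total, it is an isometry, and totality with D and L exchanged is its
    surjectivity. *)
Lemma unitary_extension H K1 K2 (D : {bop H -> K1}) (L : {bop H -> K2}) :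
  dense_range D -> dense_range L -> (forall x, rnorm (D x) = rnorm (L x)) ->
  exists U : {bop K1 -> K2}, unitary U /\ forall x, U (D x) = L x.
Proof.
move=> Dd Ld DL.
pose G := graph_closure D L.
have /choice[U hU] := graph_closure_total Dd DL.
have Gle y z : G y z -> rnorm y = rnorm z.
  move=> h; apply/eqP; rewrite eq_le; apply/andP; split; apply: le_addeps => e e0.
    have [x [h1 h2]] := h (e / 2) (divr_gt0 e0 (ltr0n _ 2)).
    have := rnormD (y - D x) (D x); rewrite subrK; have := rnormD (L x - z) z; rewrite subrK.
    by rewrite DL (rnormB y); lra.
  have [x [h1 h2]] := h (e / 2) (divr_gt0 e0 (ltr0n _ 2)).
  have := rnormD (z - L x) (L x); rewrite subrK; have := rnormD (D x - y) y; rewrite subrK.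
  by rewrite DL (rnormB z); lra.
have Glin a y z y' z' : G y z -> G y' z' -> G (a *: y + y') (a *: z + z').
  move=> h h' e e0; pose r := complex.Re `|a| + 1.
  have r0 : 0 < r by rewrite ltr_wpDl ?Re_norm_ge0.
  have e2 : 0 < e / 2 by rewrite divr_gt0.
  have [x [h1 h2]] := h (e / 2 / r) (divr_gt0 e2 r0).
  have [x' [h1' h2']] := h' _ e2.
  have key (K : hilbertType R) (u u' v v' : K) : rnorm (u - v) <= e / 2 / r ->
    rnorm (u' - v') <= e / 2 ->
      rnorm (a *: u + u' - (a *: v + v')) <= e.
    move=> k1 k2; rewrite opprD addrACA -scalerBr (le_trans (rnormD _ _))// (splitr e) lerD//.
    rewrite rnormZ; apply: (@le_trans _ _ (r * rnorm (u - v))).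
      by rewrite ler_wpM2r ?rnorm_ge0// lerDl.
    by rewrite mulrC -ler_pdivlMr.
  by exists (a *: x + x'); split; [rewrite (linearP D)|rewrite (linearP L)]; exact: key.
have Gfun y z z' : G y z -> G y z' -> z = z'.
  move=> h h'; have := Gle _ _ (Glin (-1) _ _ _ _ h h').
  rewrite !scaleN1r (addrC _ y) subrr rnorm0 (addrC _ z') => /esym/rnorm_eq0/eqP.
  by rewrite subr_eq0 => /eqP ->.
have GD x : G (D x) (L x) by move=> e e0; exists x; rewrite !subrr !rnorm0 ltW.
have Un y : rnorm (U y) = rnorm y by rewrite -(Gle _ _ (hU y)).
have [|V hV] := @bop_of R K1 K2 U.
  split; last by exists 1 => // y; rewrite Un mul1r.
  by move=> a y y'; apply: Gfun (hU _) _; apply: Glin; exact: hU.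
exists V; split; last by move=> x; rewrite hV; apply: Gfun (hU _) (GD x).
split; first by apply: isometry_hdot => x; rewrite hV Un.
move=> z; have [|y hy] := @graph_closure_total _ _ _ L D Ld _ z; first by move=> x; rewrite DL.
exists y; rewrite hV; apply: Gfun (hU y) _ => e /hy[x [h1 h2]]; by exists x.
Qed.

Lemma dense_eq H K L (D : {bop H -> K}) (S T : {bop K -> L}) : dense_range D ->
  (forall x, S (D x) = T (D x)) -> S =1 T.
Proof.
move=> Dd ST y; have [M M0 SM] := bop_rnorm S; have [N N0 TN] := bop_rnorm T.
apply: (@rnorm_eq_eps _ _ _ _ (M + N)) => e /(Dd y)[x hx].
rewrite -(subrKA (S (D x))) {2}ST -!linearB (le_trans (rnormD _ _))// mulrDl lerD//.
  by rewrite (le_trans (SM _))// ler_pM2l// rnormB.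
by rewrite (le_trans (TN _))// ler_pM2l.
Qed.

End UnitaryExtension.

(** * Hilbert sums and the Fock space *)

Section L2.
Variable R : realType.
Implicit Types (H K : hilbertType R) (I : choiceType).

(** [unordered_sum] is a limit that carries no convergence; sums are computed through this relation
    and read off by [has_sumE]. *)
Definition has_sum I H (x : I -> H) (l : H) := (partial_sum x @ totally --> l)%classic.

Lemma has_sumE I H (x : I -> H) l : has_sum x l -> unordered_sum x = l.
Proof. exact: (cvg_lim (@norm_hausdorff _ H)). Qed.

Lemma has_sum_bop I H K (T : {bop H -> K}) (x : I -> H) l :
  has_sum x l -> has_sum (fun i => T (x i)) (T l).
Proof.
move=> /cvgrPdist_le h; have [M M0 TM] := bop_bounded T.
apply/cvgrPdist_le => e e0.
have := h _ (divr_gt0 e0 M0); apply: filterS => J hJ.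
have -> : partial_sum (fun i => T (x i)) J = T (partial_sum x J).
  by rewrite !partial_sumE linear_sum.
rewrite -linearB; apply: le_trans (TM _) _.
by rewrite mulrC -ler_pdivlMr.
Qed.

Lemma l2_delta_linear I H i : linear (@l2_delta R I H i).
Proof.
move=> a x y; apply: l2_ext => j.
have -> : (a *: l2_delta i x + l2_delta i y) j = a *: l2_delta i x j + l2_delta i y j by [].
by rewrite /=; case: eqP => // _; rewrite scaler0 addr0.
Qed.

Lemma l2_deltaB I H (i : I) (x y : H) :
  l2_delta i (x - y) = l2_delta i x - l2_delta i y.
Proof.
by have := l2_delta_linear i (-1) y x; rewrite !scaleN1r (addrC _ x) (addrC _ (l2_delta i x)).
Qed.

Lemma rnorm_l2_delta I H i (x : H) : rnorm (l2_delta i x : l2 I H) = rnorm x.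
Proof.
by apply/eqP; rewrite -(@eqrXn2 _ 2) ?rnorm_ge0// -!rdot_rnorm /rdot hdot_l2_delta /= eqxx.
Qed.

Lemma l2_delta_blin I H i : bounded_linear (@l2_delta R I H i).
Proof.
by split; [exact: l2_delta_linear|exists 1 => // x; rewrite rnorm_l2_delta mul1r].
Qed.

Lemma l2_sum_eval I H (J : Type) (s : seq J) (F : J -> l2 I H) i :
  (\sum_(j <- s) F j) i = \sum_(j <- s) F j i.
Proof. by elim: s => [|j s ih]; rewrite ?big_nil ?big_cons// -ih. Qed.

Lemma l2_rnorm_sup I H (f : l2 I H) :
  (forall J, partial_sum (fun i => rnorm (f i) ^+ 2) J <= rnorm f ^+ 2) /\
  (forall M, (forall J, partial_sum (fun i => rnorm (f i) ^+ 2) J <= M) -> rnorm f ^+ 2 <= M).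
Proof.
have E (J : {fset I}) : partial_sum (fun i => `|f i| ^+ 2) J =
    (partial_sum (fun i => rnorm (f i) ^+ 2) J)%:C%C.
  rewrite !partial_sumE rmorph_sum; apply: eq_bigr => i _.
  by rewrite rnormE -rmorphXn.
have F : l2_dot_fun f f = (rnorm f ^+ 2)%:C%C by rewrite rmorphXn /= -rnormE -hdot_normE.
have [h1 h2] := l2_dot_sup f; split=> [J|M hM].
  by have := h1 J; rewrite E F lecR.
by have := h2 M%:C%C; rewrite F lecR; apply=> J; rewrite E lecR.
Qed.

(** The partial sum s over J is the truncation of f to J, so <s, f> = |s|^2 and |f - s|^2 = |f|^2 -
    |s|^2, which is small as soon as J is large. *)
Lemma l2_has_sum I H (f : l2 I H) : has_sum (fun i => l2_delta i (f i)) f.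
Proof.
apply/cvgrPdist_le => e e0; have er := real_complex_ge0 (ltW e0).
have r0 : 0 < complex.Re e by rewrite -ltcR -er.
move: (complex.Re e) er r0 => r er r0.
have [sup1 sup2] := l2_rnorm_sup f.
have [J0 hJ0] : exists J0, rnorm f ^+ 2 - r ^+ 2 < partial_sum (fun i => rnorm (f i) ^+ 2) J0.
  apply: contrapT => h.
  have : rnorm f ^+ 2 <= rnorm f ^+ 2 - r ^+ 2.
    by apply: sup2 => J; rewrite leNgt; apply/negP => hJ; apply: h; exists J.
  by have : 0 < r ^+ 2 := exprn_gt0 2 r0; lra.
exists J0 => // J /= J0J; rewrite rnormE er lecR.
rewrite -(@ler_pXn2r _ 2) ?nnegrE ?rnorm_ge0 ?(ltW r0)//.
set s := partial_sum _ J.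
have sE i : i \in J -> s i = f i.
  move=> iJ; rewrite /s partial_sumE l2_sum_eval (big_fsetD1 i)//= eqxx.
  rewrite big_seq big1 ?addr0// => j.
  by rewrite in_fsetD1 eq_sym => /andP[/negPf -> _].
have sg (g : l2 I H) : rdot s g = \sum_(i <- J) rdot (f i) (g i).
  rewrite /s partial_sumE; elim: (enum_fset J) => [|i t ih].
    by rewrite !big_nil /rdot linear0l.
  by rewrite !big_cons rdotDl ih /rdot hdot_l2_delta.
have ss : rdot s s = partial_sum (fun i => rnorm (f i) ^+ 2) J.
  rewrite sg partial_sumE big_seq [RHS]big_seq; apply: eq_bigr => i iJ.
  by rewrite sE// rdot_rnorm.
have sf : rdot s f = rdot s s.
  by rewrite ss sg partial_sumE; apply: eq_bigr => i _; rewrite rdot_rnorm.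
rewrite -rdot_rnorm rdotDl !rdotDr !rdotNl !rdotNr (rdotC f s) sf rdot_rnorm ss.
have : partial_sum (fun i => rnorm (f i) ^+ 2) J0 <= partial_sum (fun i => rnorm (f i) ^+ 2) J.
  rewrite -lecR !partial_sumE !rmorph_sum /= -!partial_sumE.
  by apply: partial_sum_sub => // i; rewrite lecR exprn_ge0 ?rnorm_ge0.
by move: hJ0; lra.
Qed.

Lemma l2_ordE d H (x : l2 'I_d H) : x = \sum_(i < d) l2_delta i (x i).
Proof.
apply: l2_ext => j; rewrite l2_sum_eval (bigD1 j)//= eqxx big1 ?addr0// => i ij.
by rewrite eq_sym (negPf ij).
Qed.

Lemma l2_ord_hdot d H (x y : l2 'I_d H) : hdot x y = \sum_(i < d) hdot (x i) (y i).
Proof.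
rewrite {1}(l2_ordE x).
elim: (index_enum _) => [|i t ih]; first by rewrite !big_nil linear0l.
by rewrite !big_cons hdotDl ih hdot_l2_delta.
Qed.

Lemma l2_ord_rnorm d H (x : l2 'I_d H) : rnorm x ^+ 2 = \sum_(i < d) rnorm (x i) ^+ 2.
Proof.
rewrite -rdot_rnorm /rdot l2_ord_hdot raddf_sum; apply: eq_bigr => i _; exact: rdot_rnorm.
Qed.

End L2.

(** * Creation operators on the Fock space *)

Section Creation.
Variables (R : realType) (d : nat) (H : hilbertType R).
Implicit Types (k : 'I_d) (f : fock d H).

Lemma annihilation_subproof k f : (fun w => f (k :: w)) \in @l2_pred R (seq 'I_d) H.
Proof.
rewrite inE; exists (rnorm f ^+ 2)%:C%C => J.
have [h _] := l2_rnorm_sup f; have := h [fset (k :: w) | w in J]%fset.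
rewrite -lecR; apply: le_trans; rewrite !partial_sumE big_imfset /=; last by move=> ? ? _ _ [].
by rewrite rmorph_sum; apply: ler_sum => w _; rewrite rnormE -rmorphXn.
Qed.

Definition annihilation_fun k f : fock d H := L2 (annihilation_subproof k f).

Lemma annihilation_blin k : bounded_linear (annihilation_fun k).
Proof.
split; first by move=> a f g; apply: l2_ext.
exists 1 => // f; rewrite mul1r -(@ler_pXn2r _ 2) ?nnegrE ?rnorm_ge0//.
have [_ h'] := l2_rnorm_sup (annihilation_fun k f); apply: h' => J.
have [h _] := l2_rnorm_sup f; have := h [fset (k :: w) | w in J]%fset.
by rewrite !partial_sumE big_imfset /=; last by move=> ? ? _ _ [].
Qed.

(* The adjoint of e_k (x) -; boundedness is immediate for it, so that the creation
   operator is defined as its adjoint. *)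
Definition annihilation k : {bop fock d H -> fock d H} :=
  projT1 (cid (bop_of (annihilation_blin k))).

Lemma annihilationE k f w : annihilation k f w = f (k :: w).
Proof. by rewrite /annihilation; case: cid => T /= ->. Qed.

Definition creation k := adj (annihilation k).

Lemma creation_delta k w (x : H) : creation k (l2_delta w x) = l2_delta (k :: w) x.
Proof.
apply: adj_eq => f.
by rewrite (dotC hdot) hdot_l2_delta annihilationE -hdot_l2_delta [RHS](dotC hdot).
Qed.

(** The sums over words under a fixed first letter k in both characteristic functions have this
    shape. *)
Lemma creation_has_sum k f : has_sum (fun w => l2_delta (k :: w) (f w)) (creation k f).
Proof.
rewrite (_ : (fun w => _) = fun w => creation k (l2_delta w (f w))).
  exact/has_sum_bop/l2_has_sum.
by apply/funext => w; rewrite creation_delta.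
Qed.

Lemma creation_nil k f : creation k f [::] = 0.
Proof.
apply: hdot_ext => x; rewrite -hdot_l2_delta -adjP linear0r.
rewrite (_ : annihilation k _ = 0) ?linear0l//.
by apply: l2_ext => w; rewrite annihilationE.
Qed.

Lemma creation_cons k f k' w : creation k f (k' :: w) = if k' == k then f w else 0.
Proof.
apply: hdot_ext => x; rewrite -hdot_l2_delta -adjP.
case: eqP => [->|kk]; last first.
  rewrite linear0r (_ : annihilation k _ = 0) ?linear0l//.
  by apply: l2_ext => v; rewrite annihilationE /= eqseq_cons eq_sym; case: eqP.
rewrite -hdot_l2_delta; congr (hdot _ f).
by apply: l2_ext => v; rewrite annihilationE /= eqseq_cons eqxx.
Qed.

End Creation.
Arguments annihilation {R d H} k.
Arguments creation {R d H} k.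

(** * Row operators, orthogonal sums and corestriction to closed ranges *)

Section Rows.
Variable R : realType.
Implicit Types H K : hilbertType R.

Lemma row_op_delta d H K (T : 'I_d -> {bop H -> K}) k x : row_op T (l2_delta k x) = T k x.
Proof.
have -> : row_op T (l2_delta k x) = \sum_(i < d) T i (l2_delta k x i) by [].
rewrite (bigD1 k)//= eqxx big1 ?addr0// => i ik.
by rewrite (negPf ik) linear0.
Qed.

Lemma adj_row_op d H K (T : 'I_d -> {bop H -> K}) k y : adj (row_op T) y k = adj (T k) y.
Proof. by apply: hdot_ext => x; rewrite -hdot_l2_delta -!adjP row_op_delta. Qed.

Lemma rdot_suml H I (s : seq I) (F : I -> H) y : rdot (\sum_(i <- s) F i) y = \sum_(i <- s)
  rdot (F i) y.
Proof.
by elim: s => [|i s ih]; rewrite ?big_nil ?big_cons ?rdotDl ?ih// /rdot linear0l.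
Qed.

(** The adjoint of the row has the components T_i^* y, so the hypothesis says that this adjoint is
    contractive, and the row is its adjoint in turn. *)
Lemma row_contractionP d H (T : 'I_d -> {bop H -> H}) : row_contraction T ->
  forall x, rnorm (row_op T x) <= rnorm x.
Proof.
move=> Tc; apply: adj_contractive_adj => y.
rewrite -(@ler_pXn2r _ 2) ?nnegrE ?rnorm_ge0// l2_ord_rnorm.
have := Tc y; rewrite lecE => /andP[_].
rewrite -/(rdot _ _) rdotDl rdotNl rdot_rnorm rdot_suml /= subr_ge0.
rewrite (eq_bigr (fun i => rnorm (adj (row_op T) y i) ^+ 2))// => i _.
by rewrite /rdot adjP adj_row_op -/(rdot _ _) rdot_rnorm.
Qed.

Lemma hprod_rdot H K (x y : hprod H K) : rdot x y = rdot x.1 y.1 + rdot x.2 y.2.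
Proof. exact: raddfD. Qed.

Lemma hprod_rnorm H K (x : hprod H K) : rnorm x ^+ 2 = rnorm x.1 ^+ 2 + rnorm x.2 ^+ 2.
Proof. by rewrite -!rdot_rnorm hprod_rdot. Qed.

Lemma hprod_rnorm_le H K (x : hprod H K) : rnorm x <= rnorm x.1 + rnorm x.2.
Proof.
rewrite -(@ler_pXn2r _ 2) ?nnegrE ?addr_ge0 ?rnorm_ge0// hprod_rnorm sqrrD addrAC lerDl.
by rewrite mulrn_wge0// mulr_ge0 ?rnorm_ge0.
Qed.

Lemma hprod_rnorm_snd H K (x : hprod H K) : rnorm x.2 <= rnorm x.
Proof. by rewrite -(@ler_pXn2r _ 2)
  ?nnegrE ?rnorm_ge0// hprod_rnorm lerDr exprn_ge0 ?rnorm_ge0. Qed.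

Lemma pair_blin H H1 H2 (f : H -> H1) (g : H -> H2) : bounded_linear f -> bounded_linear g ->
  bounded_linear (fun x => (f x, g x) : hprod H1 H2).
Proof.
move=> [fl [M M0 fM]] [gl [N N0 gN]]; split.
  by move=> a x y; rewrite fl gl.
exists (M + N); first exact: addr_gt0.
by move=> x; rewrite (le_trans (hprod_rnorm_le _))//= mulrDl lerD.
Qed.

Lemma cst0_blin H K : bounded_linear (fun _ : H => 0 : K).
Proof. exact: (bop_bounded_linear (bop0 H K)). Qed.

Lemma id_blin H : bounded_linear (fun x : H => x).
Proof. exact: (bop_bounded_linear (bop_id H)). Qed.

Definition bop_inl H K : {bop H -> hprod H K} :=
  projT1 (cid (bop_of (pair_blin (@id_blin H) (cst0_blin H K)))).
Definition bop_inr H K : {bop K -> hprod H K} :=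
  projT1 (cid (bop_of (pair_blin (cst0_blin K H) (@id_blin K)))).

Lemma bop_inlE H K x : bop_inl H K x = hprod_inl x.
Proof. by rewrite /bop_inl; case: cid => T /= ->. Qed.
Lemma bop_inrE H K x : bop_inr H K x = hprod_inr x.
Proof. by rewrite /bop_inr; case: cid => T /= ->. Qed.

Lemma hprod_sum_fst H K (I : Type) (s : seq I) (F : I -> hprod H K) :
  (\sum_(i <- s) F i).1 = \sum_(i <- s) (F i).1.
Proof. by elim: s => [|i s ih]; rewrite ?big_nil ?big_cons// -ih. Qed.
Lemma hprod_sum_snd H K (I : Type) (s : seq I) (F : I -> hprod H K) :
  (\sum_(i <- s) F i).2 = \sum_(i <- s) (F i).2.
Proof. by elim: s => [|i s ih]; rewrite ?big_nil ?big_cons// -ih. Qed.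

Lemma l2_addE (I : choiceType) H (f g : l2 I H) i : (f + g) i = f i + g i.
Proof. by []. Qed.

Lemma l2_delta0 (I : choiceType) H (i : I) : l2_delta i (0 : H) = 0.
Proof. by apply: l2_ext => j /=; case: eqP. Qed.

Lemma l2_map_fst_inl (I : choiceType) H K (x : l2 I H) :
  l2_map (bop_fst H K) (l2_map (bop_inl H K) x) = x.
Proof. by apply: l2_ext => i /=; rewrite bop_inlE. Qed.
Lemma l2_map_fst_inr (I : choiceType) H K (x : l2 I K) :
  l2_map (bop_fst H K) (l2_map (bop_inr H K) x) = 0.
Proof. by apply: l2_ext => i /=; rewrite bop_inrE. Qed.
Lemma l2_map_snd_inl (I : choiceType) H K (x : l2 I H) :
  l2_map (bop_snd H K) (l2_map (bop_inl H K) x) = 0.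
Proof. by apply: l2_ext => i /=; rewrite bop_inlE. Qed.
Lemma l2_map_snd_inr (I : choiceType) H K (x : l2 I K) :
  l2_map (bop_snd H K) (l2_map (bop_inr H K) x) = x.
Proof. by apply: l2_ext => i /=; rewrite bop_inrE. Qed.

Lemma hprod_inl_inr H K (x : hprod H K) :
  hprod_inl x.1 + hprod_inr x.2 = x.
Proof.
by case: x => a b; transitivity ((a + 0, 0 + b) : hprod H K) => //; rewrite addr0 add0r.
Qed.

Lemma l2_hprod_rnorm d H K (x : l2 'I_d (hprod H K)) :
  rnorm x ^+ 2 = rnorm (l2_map (bop_fst H K) x) ^+ 2 + rnorm (l2_map (bop_snd H K) x) ^+ 2.
Proof.
rewrite !l2_ord_rnorm -big_split /=; apply: eq_bigr => i _; exact: hprod_rnorm.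
Qed.

(** T as an operator onto a dense subspace of its closed range; on this range [corestr] never takes
    its default value. *)
Definition to_ran H K (T : {bop H -> K}) : {bop H -> ran_closure T} :=
  projT1 (cid (bop_of (corestr_blin (@ran_closure_mem R H K T) (bop_bounded_linear T)))).

Lemma to_ranE H K (T : {bop H -> K}) x : corestr (T x) = to_ran T x.
Proof. by rewrite /to_ran; case: cid => S /= ->. Qed.

Lemma val_to_ran H K (T : {bop H -> K}) x : hsub_val (to_ran T x) = T x.
Proof. by rewrite -to_ranE corestrK// ran_closure_mem. Qed.

Lemma to_ran_dense H K (T : {bop H -> K}) : dense_range (to_ran T).
Proof.
move=> [y yT] e e0; have /ran_closureP/(_ e e0)[x hx] := yT.
by exists x; rewrite -rnorm_hsub /= val_to_ran rnormB.
Qed.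

Lemma dense_range_comp H K L (S : {bop K -> L}) (T : {bop H -> K}) :
  dense_range S -> dense_range T -> dense_range (bop_comp S T).
Proof.
move=> Sd Td z e e0; have e2 : 0 < e / 2 by rewrite divr_gt0.
have [y hy] := Sd z _ e2; have [M M0 SM] := bop_rnorm S.
have [x hx] := Td y _ (divr_gt0 e2 M0).
exists x; rewrite /= -(subrKA (S y)) (le_trans (rnormD _ _))// (splitr e) lerD//.
by rewrite -linearB (le_trans (SM _))// mulrC -ler_pdivlMr.
Qed.

End Rows.

(** The sum over |w| >= 1 in theta_{C,E} is a full Fock vector minus its vacuum component. *)
Lemma has_sum_nonempty (R : realType) (d : nat) (H : hilbertType R) (f : fock d H) :
  has_sum (fun w => if (0 < size w)%N then l2_delta w (f w) else 0)
    (f - l2_delta [::] (f [::])).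
Proof.
have := @l2_has_sum R _ _ (f - l2_delta [::] (f [::])).
congr has_sum; apply/funext => w; rewrite l2_addE.
have -> : (- l2_delta [::] (f [::])) w = - l2_delta [::] (f [::]) w by [].
by case: w => [|k w] /=; rewrite ?subrr ?subr0 ?l2_delta0.
Qed.

(* The operator x |-> \sum_w e_w (x) Dstar (A_w^* x), bounded by telescoping. *)
Section PoissonKernel.
Variables (R : realType) (d : nat) (H : hilbertType R) (A : 'I_d -> {bop H -> H}).
Hypothesis Ac : forall x, rnorm (row_op A x) <= rnorm x.

Local Notation Dstar := (defect_star (row_op A)).

Lemma adj_word_op_cons k w x : adj (word_op A (k :: w)) x = adj (word_op A w) (adj (A k) x).
Proof. exact: adj_comp. Qed.

Lemma adj_word_op_nil x : adj (word_op A [::]) x = x.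
Proof. by apply: adj_eq => y. Qed.

Let kernel x w := rnorm (Dstar (adj (word_op A w) x)) ^+ 2.

(** The words of length less than n, grouped by first letter, because A_(kw)^* = A_w^* A_k^* peels
    off the first letter. *)
Let words := fix words n : seq (seq 'I_d) :=
  if n is m.+1 then [::] :: [seq k :: w | k <- enum 'I_d, w <- words m] else [::].

(* The sum telescopes: |Dstar y|^2 = |y|^2 - \sum_k |A_k^* y|^2. *)
Lemma sum_words n x : \sum_(w <- words n) kernel x w <= rnorm x ^+ 2.
Proof.
elim: n x => [|n ih] x /=; first by rewrite big_nil exprn_ge0 ?rnorm_ge0.
rewrite big_cons big_allpairs_dep /= {1}/kernel adj_word_op_nil (defect_star_norm Ac).
rewrite addrAC -lerBrDr opprK lerD2l l2_ord_rnorm big_enum /=.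
apply: ler_sum => k _; rewrite adj_row_op; apply: le_trans (ih (adj (A k) x)).
by apply: ler_sum => w _; rewrite /kernel adj_word_op_cons.
Qed.

Lemma mem_words n w : (size w < n)%N -> w \in words n.
Proof.
elim: n w => [//|n ih] [|k w] //= wn.
rewrite inE; apply/orP; right; apply/allpairsP; exists (k, w).
by split => //=; [rewrite mem_enum|exact: ih].
Qed.

Lemma ler_sum_subset (T : eqType) (F : T -> R) (s t : seq T) : (forall i, 0 <= F i) ->
  uniq s -> {subset s <= t} -> \sum_(i <- s) F i <= \sum_(i <- t) F i.
Proof.
move=> F0; elim: s t => [|x s ih] t /=; first by rewrite big_nil sumr_ge0.
move=> /andP[xs us] st; have xt : x \in t by apply: st; rewrite inE eqxx.
rewrite (perm_big _ (perm_to_rem xt)) /= !big_cons lerD2l; apply: ih => // y ys.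
have yx : y != x by apply: contraNneq xs => <-.
have := st y; rewrite inE ys orbT => /(_ isT).
by rewrite (perm_mem (perm_to_rem xt)) inE (negPf yx).
Qed.

Lemma poisson_partial_sum x (J : {fset seq 'I_d}) : \sum_(w <- J) kernel x w <= rnorm x ^+ 2.
Proof.
pose n := (\max_(w <- J) size w).+1.
apply: le_trans (sum_words n x); apply: ler_sum_subset => //.
  by move=> w; rewrite exprn_ge0 ?rnorm_ge0.
by move=> w wJ; apply: mem_words; rewrite ltnS; apply: leq_bigmax_seq.
Qed.

Lemma poisson_subproof x :
  (fun w => to_ran Dstar (adj (word_op A w) x)) \in @l2_pred R (seq 'I_d) _.
Proof.
rewrite inE; exists (rnorm x ^+ 2)%:C%C => J; rewrite partial_sumE.
rewrite (eq_bigr (fun w => (kernel x w)%:C%C)); last first.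
  by move=> w _; rewrite rnormE -rmorphXn /= -rnorm_hsub val_to_ran.
by rewrite -rmorph_sum lecR; exact: poisson_partial_sum.
Qed.

Definition poisson_fun x : fock d (defect_star_space (row_op A)) := L2 (poisson_subproof x).

Lemma poisson_blin : bounded_linear poisson_fun.
Proof.
split; first by move=> a x y; apply: l2_ext => w; rewrite /= !linearP.
exists 1 => // x; rewrite mul1r -(@ler_pXn2r _ 2) ?nnegrE ?rnorm_ge0//.
have [_ h] := l2_rnorm_sup (poisson_fun x); apply: h => J; rewrite partial_sumE.
apply: le_trans (poisson_partial_sum x J); apply: ler_sum => w _.
by rewrite -rnorm_hsub /= val_to_ran.
Qed.

Definition poisson := projT1 (cid (bop_of poisson_blin)).

Lemma poissonE x w : poisson x w = to_ran Dstar (adj (word_op A w) x).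
Proof. by rewrite /poisson; case: cid => T /= ->. Qed.

Lemma poisson_rec x :
  poisson x = l2_delta [::] (to_ran Dstar x) + \sum_(k < d) creation k (poisson (adj (A k) x)).
Proof.
apply: l2_ext => w; rewrite poissonE l2_addE l2_sum_eval.
case: w => [|k w].
  rewrite big1; last by move=> k _; exact: creation_nil.
  by rewrite addr0 adj_word_op_nil.
have -> : l2_delta [::] (to_ran Dstar x) (k :: w) = 0 by [].
rewrite add0r (bigD1 k) //= creation_cons eqxx big1 ?addr0; last first.
  by move=> k' kk'; rewrite creation_cons eq_sym (negPf kk').
by rewrite poissonE -adj_word_op_cons.
Qed.

(** Ensures that the vacuum term of theta_A is the true vector A x and not the default 0 of
    [corestr]. *)
Lemma row_op_defect_space x : x \in hsub_pred (defect_space (row_op A)) ->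
  row_op A x \in hsub_pred (defect_star_space (row_op A)).
Proof.
apply: map_ran_closure => y.
by rewrite -(defect_intertwine Ac) ran_closure_mem.
Qed.

Lemma adj_row_op_defect_star_space x : x \in hsub_pred (defect_star_space (row_op A)) ->
  adj (row_op A) x \in hsub_pred (defect_space (row_op A)).
Proof.
apply: map_ran_closure => y.
by rewrite -(adj_defect_intertwine Ac) ran_closure_mem.
Qed.

Lemma char_funE (x : defect_space (row_op A)) :
  char_fun x = - l2_delta [::] (corestr (row_op A (hsub_val x)))
    + \sum_(k < d) creation k (poisson (defect (row_op A) (hsub_val x) k)).
Proof.
congr (_ + _); apply: eq_bigr => k _; apply: has_sumE.
have := @creation_has_sum R d _ k (poisson (defect (row_op A) (hsub_val x) k)).
by congr has_sum; apply/funext => w; rewrite poissonE to_ranE.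
Qed.

Lemma l2_eval_blin (I : choiceType) (K : hilbertType R) i : bounded_linear (fun f :
  l2 I K => f i).
Proof.
split=> //; exists 1 => // f; rewrite mul1r -(@ler_pXn2r _ 2) ?nnegrE ?rnorm_ge0//.
by have [/(_ [fset i]%fset) + _] := l2_rnorm_sup f; rewrite partial_sumE big_seq_fset1.
Qed.

Lemma char_fun_blin : bounded_linear (@char_fun R d H A).
Proof.
apply: bounded_linear_eq (fun x => esym (char_funE x)) _.
apply: bounded_linearD.
  apply: bounded_linearN; apply: (bounded_linear_comp _ (@l2_delta_blin R _ _ _)).
  apply: (@corestr_blin _ _ _ _ (fun x => row_op A (hsub_val x))).
    by move=> [x xA]; exact: row_op_defect_space.
  exact: bounded_linear_comp (hsub_val_blin _) (bop_bounded_linear _).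
apply: bounded_linear_sum => k.
have h := bounded_linear_comp (@hsub_val_blin R _ (defect_space (row_op A)))
  (bop_bounded_linear (defect (row_op A))).
have h2 := bounded_linear_comp (bounded_linear_comp h (l2_eval_blin _ k))
  (bop_bounded_linear poisson).
exact: bounded_linear_comp h2 (bop_bounded_linear (creation k)).
Qed.

End PoissonKernel.

Local Arguments row_op : simpl never.
Local Arguments l2_map : simpl never.

(** * The lifting and its characteristic function *)

Section LiftingDefect.
Variables (R : realType) (d : nat) (HC HA : hilbertType R).
Variables (C : 'I_d -> {bop HC -> HC}) (A : 'I_d -> {bop HA -> HA}).
Variables (B : 'I_d -> {bop HC -> HA}).
Variables (E : 'I_d -> {bop hprod HC HA -> hprod HC HA}).
Hypothesis Cc : forall x, rnorm (row_op C x) <= rnorm x.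
Hypothesis Ec : forall x, rnorm (row_op E x) <= rnorm x.
Hypothesis Eform : lower_triangular_lifting C A B E.
Variable gamma : {bop defect_star_space (row_op A) -> defect_space (row_op C)}.
Hypothesis gammac : forall x, rnorm (gamma x) <= rnorm x.
Hypothesis hB : forall x : HA,
     adj (row_op B) x =
     defect (row_op C) (hsub_val (gamma (corestr (defect_star (row_op A) x)))).

Local Notation RA := (row_op A).
Local Notation RB := (row_op B).
Local Notation RC := (row_op C).
Local Notation RE := (row_op E).
Local Notation prC := (l2_map (bop_fst HC HA)).
Local Notation prA := (l2_map (bop_snd HC HA)).

Lemma row_op_lifting x : RE x = (RC (prC x), RB (prC x) + RA (prA x)).
Proof.
have -> : RE x = \sum_(i < d) E i (x i) by [].
rewrite [LHS]surjective_pairing hprod_sum_fst hprod_sum_snd.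
congr (_, _).
  by apply: eq_bigr => i _; rewrite Eform.
have -> : RB (prC x) + RA (prA x) = \sum_(i < d) (B i (x i).1 + A i (x i).2).
  by rewrite big_split.
by apply: eq_bigr => i _; rewrite Eform.
Qed.

(** On vectors without H_C components the row E reduces to A, followed by the inclusion of H_A. *)
Lemma lifting_corner_contractive x : rnorm (RA x) <= rnorm x.
Proof.
have := Ec (l2_map (bop_inr HC HA) x).
rewrite row_op_lifting l2_map_fst_inr l2_map_snd_inr !linear0 add0r => h.
have xE : rnorm (l2_map (bop_inr HC HA) x) ^+ 2 = rnorm x ^+ 2.
  by rewrite l2_hprod_rnorm l2_map_fst_inr l2_map_snd_inr rnorm0 expr0n add0r.
move/eqP: xE; rewrite eqrXn2 ?rnorm_ge0// => /eqP <-.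
exact: le_trans (hprod_rnorm_snd _) h.
Qed.
Local Notation Ac := lifting_corner_contractive.

Lemma lifting_corner_factor x :
  RB x = defect_star RA (hsub_val (adj gamma (to_ran (defect RC) x))).
Proof.
apply: hdot_ext => h.
rewrite -adjP2 hB (to_ranE (defect_star RA)).
rewrite (defect_sa Cc) -(val_to_ran (defect RC) x).
rewrite -(defect_star_sa Ac) -(val_to_ran (defect_star RA) h).
by rewrite !hdot_hsub adjP.
Qed.

Local Notation dC x := (to_ran (defect RC) x).
Local Notation v x := (hsub_val (adj gamma (dC x))).

Lemma lift_sigma_mem x : - adj RA (v (prC x)) + defect RA (prA x)
  \in hsub_pred (defect_space RA).
Proof.
apply: rpredD; last exact: ran_closure_mem.
by rewrite rpredN; apply: (adj_row_op_defect_star_space Ac); case: (adj gamma _).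
Qed.

(* The right-hand side of the formula for sigma D_E. *)
Definition lift_sigma_fun x : hprod (defect_star_space gamma) (defect_space RA) :=
  (to_ran (defect_star gamma) (dC (prC x)),
   corestr (- adj RA (v (prC x)) + defect RA (prA x))).

Lemma lift_sigma_blin : bounded_linear lift_sigma_fun.
Proof.
have bC : bounded_linear (fun x => dC (prC x)).
  exact: bounded_linear_comp (bop_bounded_linear _) (bop_bounded_linear (to_ran (defect RC))).
apply: pair_blin.
  exact: bounded_linear_comp bC (bop_bounded_linear (to_ran (defect_star gamma))).
apply: (corestr_blin lift_sigma_mem); apply: bounded_linearD.
  apply: bounded_linearN.
  have b1 := bounded_linear_comp bC (bop_bounded_linear (adj gamma)).
  have b2 := bounded_linear_comp b1 (@hsub_val_blin _ _ _).
  exact: bounded_linear_comp b2 (bop_bounded_linear (adj RA)).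
exact: bounded_linear_comp (bop_bounded_linear _) (bop_bounded_linear (defect RA)).
Qed.

Lemma lift_sigma_norm x : rnorm (lift_sigma_fun x) = rnorm (to_ran (defect RE) x).
Proof.
pose xC := prC x; pose xA := prA x.
have h1 : rnorm (defect RA xA) ^+ 2 = rnorm xA ^+ 2 - rnorm (RA xA) ^+ 2 := defect_norm Ac xA.
have h2 : rnorm (RB xC) ^+ 2 = rnorm (v xC) ^+ 2 - rnorm (adj RA (v xC)) ^+ 2.
  by rewrite lifting_corner_factor (defect_star_norm Ac).
(* The two cross terms agree: <A^* v, D_A x_A> = <v, D_{*,A} A x_A> = <B x_C, A x_A>. They enter
   both squared norms with the factor -2. *)
have h3 : rdot (adj RA (v xC)) (defect RA xA) = rdot (RB xC) (RA xA).
  by rewrite lifting_corner_factor /rdot (defect_star_sa Ac) (defect_intertwine Ac) adjP2.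
have h4 : rnorm (to_ran (defect_star gamma) (dC xC)) ^+ 2 = rnorm (dC xC)
  ^+ 2 - rnorm (adj gamma (dC xC)) ^+ 2.
  by rewrite -rnorm_hsub val_to_ran (defect_star_norm gammac).
have h5 : rnorm (dC xC) ^+ 2 = rnorm xC ^+ 2 - rnorm (RC xC) ^+ 2.
  by rewrite -rnorm_hsub val_to_ran (defect_norm Cc).
have h6 : rnorm x ^+ 2 = rnorm xC ^+ 2 + rnorm xA ^+ 2 := l2_hprod_rnorm x.
have h7 : rnorm (RE x) ^+ 2 = rnorm (RC xC) ^+ 2 + rnorm (RB xC + RA xA) ^+ 2.
  by rewrite row_op_lifting; exact: hprod_rnorm.
have h8 : rnorm (- adj RA (v xC) + defect RA xA) ^+ 2 =
    rnorm (adj RA (v xC)) ^+ 2 - 2 * rdot (RB xC) (RA xA) + rnorm (defect RA xA) ^+ 2.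
  by rewrite -h3 -!rdot_rnorm rdotDl !rdotDr !rdotNl !rdotNr (rdotC (defect RA xA)); ring.
have h9 : rnorm (RB xC + RA xA) ^+ 2 = rnorm (RB xC) ^+ 2 + 2 * rdot (RB xC) (RA xA)
  + rnorm (RA xA) ^+ 2.
  by rewrite -!rdot_rnorm rdotDl !rdotDr (rdotC (RA xA)); ring.
have h10 : rnorm (corestr (- adj RA (v xC) + defect RA xA) : defect_space RA)
    = rnorm (- adj RA (v xC) + defect RA xA).
  by rewrite -rnorm_hsub corestrK ?lift_sigma_mem.
have h11 : rnorm (lift_sigma_fun x) ^+ 2 = rnorm (to_ran (defect_star gamma) (dC xC)) ^+ 2 +
    rnorm (corestr (- adj RA (v xC) + defect RA xA) : defect_space RA) ^+ 2 := hprod_rnorm _.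
have h12 : rnorm (to_ran (defect RE) x) ^+ 2 = rnorm x ^+ 2 - rnorm (RE x) ^+ 2.
  by rewrite -rnorm_hsub val_to_ran (defect_norm Ec).
have h13 : rnorm (v xC) = rnorm (adj gamma (dC xC)) := rnorm_hsub _.
apply/eqP; rewrite -(@eqrXn2 _ 2) ?rnorm_ge0//; apply/eqP.
rewrite h11 h10 h12 h4 h8 h6 h7 h5 h9 h2 h1 h13.
move: (rdot _ _) (rnorm _) (rnorm _) (rnorm _) (rnorm _) (rnorm _) (rnorm _) => *; ring.
Qed.

Lemma lift_sigma_dense (L : {bop l2 'I_d (hprod HC HA) ->
  hprod (defect_star_space gamma) (defect_space RA)}) :
  L =1 lift_sigma_fun -> dense_range L.
Proof.
move=> LE [p q] e e0; have e2 : 0 < e / 2 by rewrite divr_gt0.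
have dd := dense_range_comp (@to_ran_dense _ _ _ (defect_star gamma))
  (@to_ran_dense _ _ _ (defect RC)).
have [xC hC] := dd p _ e2.
have vA : adj RA (v xC) \in hsub_pred (defect_space RA).
  by apply: (adj_row_op_defect_star_space Ac); case: (adj gamma _).
(* x_A is chosen after x_C, with the target q shifted by A^* v to offset the off-diagonal entry -
   A^* v. *)
have [xA hA] := @to_ran_dense _ _ _ (defect RA) (q + corestr (adj RA (v xC))) _ e2.
pose X := l2_map (bop_inl HC HA) xC + l2_map (bop_inr HC HA) xA.
have XC : prC X = xC by rewrite /X bopD l2_map_fst_inl l2_map_fst_inr addr0.
have XA : prA X = xA by rewrite /X bopD l2_map_snd_inl l2_map_snd_inr add0r.
have k1 : rnorm (to_ran (defect_star gamma) (dC (prC X)) - p) <= e / 2.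
  by rewrite XC; exact: hC.
have k2 : rnorm ((corestr (- adj RA (v (prC X)) + defect RA (prA X)) :
  defect_space RA) - q) <= e / 2.
  rewrite XC XA (_ : _ - q = to_ran (defect RA) xA - (q + corestr (adj RA (v xC)))) //.
  apply: hsub_inj; have mem := lift_sigma_mem X; rewrite XC XA in mem.
  rewrite !hsubB hsubD !corestrK// val_to_ran.
  by rewrite (addrC (- _) (defect RA xA)) opprD addrA addrAC.
exists X; rewrite LE (splitr e).
apply: le_trans (hprod_rnorm_le _) _; apply: lerD; [exact: k1|exact: k2].
Qed.

Lemma lift_sigma_ex : exists sigma : {bop defect_space RE ->
  hprod (defect_star_space gamma) (defect_space RA)},
  unitary sigma /\ forall x, sigma (to_ran (defect RE) x) = lift_sigma_fun x.
Proof.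
have [L LE] := bop_of lift_sigma_blin.
have [|//|x|s [su sE]] := @unitary_extension _ _ _ _ (to_ran (defect RE)) L.
- exact: to_ran_dense.
- exact: lift_sigma_dense.
- by rewrite LE lift_sigma_norm.
by exists s; split=> // x; rewrite sE LE.
Qed.

(** * The candidate symbol and the defining equations of theta_{C,E} *)

Section Symbol.
Variable sigma : {bop defect_space RE -> hprod (defect_star_space gamma) (defect_space RA)}.
Hypothesis sigmaE : forall x, sigma (to_ran (defect RE) x) = lift_sigma_fun x.

Definition lift_symbol_fun y : fock d (defect_space RC) :=
  l2_delta [::] (defect_star gamma (hsub_val (sigma y).1))
    + l2_map gamma (char_fun (sigma y).2).

Lemma lift_symbol_blin : bounded_linear lift_symbol_fun.
Proof.
have s1 := bounded_linear_comp (bop_bounded_linear sigma) (bop_bounded_linear (bop_fst _ _)).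
have s2 := bounded_linear_comp (bop_bounded_linear sigma) (bop_bounded_linear (bop_snd _ _)).
apply: bounded_linearD.
  have b1 := bounded_linear_comp s1 (@hsub_val_blin _ _ _).
  have b2 := bounded_linear_comp b1 (bop_bounded_linear (defect_star gamma)).
  exact: bounded_linear_comp b2 (@l2_delta_blin _ _ _ _).
have b1 := bounded_linear_comp s2 (char_fun_blin Ac).
exact: bounded_linear_comp b1 (bop_bounded_linear (l2_map gamma)).
Qed.

Lemma char_fun_adj z (g : defect_star_space RA) :
  hsub_val z = - adj RA (hsub_val g) ->
  char_fun z = l2_delta [::] g - poisson Ac (defect_star RA (hsub_val g)).
Proof.
move=> zE; rewrite (char_funE Ac) zE; set b := defect_star RA _.
have gA : adj RA (hsub_val g) \in hsub_pred (defect_space RA).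
  by apply: (adj_row_op_defect_star_space Ac); case: g {zE b}.
(* A A^* = I - D_{*,A}^2 leaves a vacuum term D_{*,A} b next to g; it cancels against the vacuum
   term in the recursion for [poisson Ac b]. *)
have h1 : corestr (RA (- adj RA (hsub_val g))) = to_ran (defect_star RA) b - g.
  apply: hsub_inj; rewrite corestrK; last by apply: (row_op_defect_space Ac); rewrite rpredN.
  by rewrite linearN /= val_to_ran /b (defect_star2 Ac) addrAC subrr add0r.
have h2 k : poisson Ac (defect RA (- adj RA (hsub_val g)) k) = - poisson Ac (adj (A k) b).
  have -> : defect RA (- adj RA (hsub_val g)) = - adj RA b.
    by rewrite bopN (adj_defect_intertwine Ac).
  have -> : (- adj RA b) k = - adj (A k) b by rewrite -adj_row_op.
  exact: bopN.
rewrite h1 (poisson_rec Ac b) (eq_bigr (fun k => - creation k (poisson Ac (adj (A k) b))));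
  last first.
  by move=> k _; rewrite h2 bopN.
by rewrite sumrN l2_deltaB opprB opprD addrA.
Qed.

Variable Theta : {bop defect_space RE -> fock d (defect_space RC)}.
Hypothesis ThetaE : Theta =1 lift_symbol_fun.

Lemma lift_symbol_inl j hc :
  Theta (corestr (defect RE (l2_delta j (hprod_inl hc)))) =
    l2_delta [::] (corestr (defect RC (l2_delta j hc))
                      - gamma (corestr (defect_star RA (B j hc))))
    - unordered_sum (fun w => if (0 < size w)%N then l2_delta w
           (gamma (corestr (defect_star RA (adj (word_op A w) (B j hc)))))
           else 0).
Proof.
rewrite (to_ranE (defect RE)) ThetaE /lift_symbol_fun sigmaE.
set X := l2_delta j _.
have XC : prC X = l2_delta j hc := l2_map_delta (bop_fst HC HA) j _.
have XA : prA X = 0 by rewrite /X l2_map_delta; exact: l2_delta0.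
pose z := dC (l2_delta j hc); pose g := adj gamma z.
have bE : defect_star RA (hsub_val g) = B j hc by rewrite -lifting_corner_factor row_op_delta.
(* D_{*,gamma}^2 = I - gamma gamma^* produces - gamma g, which the vacuum term gamma g of the
   theta_A part cancels. What remains is e_0 (x) z minus the image under gamma of the Poisson kernel
   at B_j h_c. *)
have s1 : defect_star gamma (hsub_val (lift_sigma_fun X).1) = z - gamma g.
  have -> : hsub_val (lift_sigma_fun X).1 = defect_star gamma z.
    by rewrite -[LHS]/(hsub_val (to_ran _ _)) val_to_ran XC.
  exact: defect_star2.
have s2 : hsub_val (lift_sigma_fun X).2 = - adj RA (hsub_val g).
  rewrite -[LHS]/(hsub_val (corestr _)) corestrK ?lift_sigma_mem//.
  by rewrite XC XA bop0E addr0.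
rewrite s1 (char_fun_adj s2) bE (to_ranE (defect RC)) -/z (to_ranE (defect_star RA)).
have us : unordered_sum (fun w => if (0 < size w)%N then l2_delta w
           (gamma (corestr (defect_star RA (adj (word_op A w) (B j hc)))))
           else 0) = l2_map gamma (poisson Ac (B j hc)) -
             l2_delta [::] (gamma (to_ran (defect_star RA) (B j hc))).
  apply: has_sumE; have := @has_sum_nonempty _ _ _ (l2_map gamma (poisson Ac (B j hc))).
  have pE w : l2_map gamma (poisson Ac (B j hc)) w = gamma (poisson Ac (B j hc) w) by [].
  rewrite pE poissonE adj_word_op_nil; congr has_sum; apply/funext => w.
  by rewrite pE poissonE to_ranE.
rewrite us bopB l2_map_delta !l2_deltaB opprB !addrA.
by rewrite !subrK.
Qed.

(** Here sigma D_E gives (0, D_A iota_j h_a); the second factor of D_A^2 is the one inside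
    theta_A. *)
Lemma lift_symbol_inr j ha :
  Theta (corestr (defect RE (l2_delta j (hprod_inr ha)))) =
    - l2_delta [::] (gamma (corestr (RA (defect RA (l2_delta j ha)))))
    + \sum_(k < d) unordered_sum (fun w => l2_delta (k :: w)
        (gamma (corestr (defect_star RA (adj (word_op A w)
           (defect RA (defect RA (l2_delta j ha)) k)))))).
Proof.
rewrite (to_ranE (defect RE)) ThetaE /lift_symbol_fun sigmaE.
set X := l2_delta j _.
have XA : prA X = l2_delta j ha := l2_map_delta (bop_snd HC HA) j _.
have XC : prC X = 0 by rewrite /X l2_map_delta; exact: l2_delta0.
have s1 : defect_star gamma (hsub_val (lift_sigma_fun X).1) = 0.
  by rewrite /lift_sigma_fun XC !bop0E.
have s2 : (lift_sigma_fun X).2 = to_ran (defect RA) (l2_delta j ha).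
  apply: hsub_inj; rewrite -[LHS]/(hsub_val (corestr _)) corestrK ?lift_sigma_mem//.
  by rewrite XC XA !bop0E val_to_ran oppr0 add0r.
rewrite s1 s2 l2_delta0 add0r (char_funE Ac) val_to_ran bopD bopN l2_map_delta bop_sum.
congr (_ + _); apply: eq_bigr => k _; apply/esym/has_sumE.
set y := defect RA _ k.
have := @has_sum_bop _ _ _ _ (l2_map gamma) _ _ (@creation_has_sum R d _ k (poisson Ac y)).
by congr has_sum; apply/funext => w; rewrite l2_map_delta poissonE to_ranE.
Qed.

Lemma lift_char_funE : lift_char_fun C A B E gamma =1 lift_symbol_fun.
Proof.
(* A witness is needed before the chosen operator can be known to satisfy the equations, as opposed
   to being the default [bop0]. *)
have TP : @is_lift_char_fun R d HC HA C A B E gamma Theta.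
  by split; [exact: lift_symbol_inl|exact: lift_symbol_inr].
have [P1 P2] := xgetPex (bop0 _ _)
  (ex_intro [set T | @is_lift_char_fun R d HC HA C A B E gamma T]%classic Theta TP).
move=> y; rewrite -ThetaE; apply: dense_eq (@to_ran_dense _ _ _ (defect RE)) _ _ => x {y}.
have -> : x = \sum_(j < d) (l2_delta j (hprod_inl (x j).1) + l2_delta j (hprod_inr (x j).2)).
  rewrite {1}(l2_ordE x); apply: eq_bigr => j _.
  have := l2_delta_linear j 1 (hprod_inl (x j).1) (hprod_inr (x j).2 : hprod HC HA).
  by rewrite !scale1r => <-; rewrite hprod_inl_inr.
rewrite !bop_sum; apply: eq_bigr => j _; rewrite !bopD -!to_ranE.
congr (_ + _).
  exact: etrans (P1 j _) (esym (lift_symbol_inl j _)).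
exact: etrans (P2 j _) (esym (lift_symbol_inr j _)).
Qed.

End Symbol.

End LiftingDefect.

Theorem lemma4p3 (R : realType) (d : nat) (HC HA : hilbertType R)
  (C : 'I_d -> {bop HC -> HC}) (A : 'I_d -> {bop HA -> HA})
  (B : 'I_d -> {bop HC -> HA})
  (E : 'I_d -> {bop hprod HC HA -> hprod HC HA})
  (hC : row_contraction C)
  (hE : row_contraction E)
  (hEform : lower_triangular_lifting C A B E)
  (hEmin : minimal_lifting E)
  (gamma : {bop defect_star_space (row_op A) -> defect_space (row_op C)})
  (hgamma : contractive_op gamma)
  (hB : forall x : HA,
     adj (row_op B) x =
     defect (row_op C) (hsub_val (gamma (corestr (defect_star (row_op A) x))))) :
  exists sigma : {bop defect_space (row_op E) ->
                      hprod (defect_star_space gamma) (defect_space (row_op A))},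
    [/\ unitary sigma,
        (forall x : l2 'I_d (hprod HC HA),
           let xC := l2_map (bop_fst HC HA) x in
           let xA := l2_map (bop_snd HC HA) x in
           let y := sigma (corestr (defect (row_op E) x)) in
           hsub_val y.1 = defect_star gamma (corestr (defect (row_op C) xC)) /\
           hsub_val y.2 = - adj (row_op A) (hsub_val (adj gamma (corestr (defect (row_op C) xC))))
                     + defect (row_op A) xA)
      & (forall x : defect_space (row_op E),
           lift_char_fun C A B E gamma x =
           l2_delta [::] (defect_star gamma (hsub_val (sigma x).1))
           + l2_map gamma (char_fun (sigma x).2))].
Proof.
have Cc := row_contractionP hC; have Ec := row_contractionP hE.
have gc := (contractiveP gamma).1 hgamma.
have [sigma [su sE]] := lift_sigma_ex Cc Ec hEform gc hB.
have [Theta ThetaE] := bop_of (lift_symbol_blin Ec hEform sigma).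
exists sigma; split=> //.
  move=> x xC xA y.
  rewrite /y (to_ranE (defect (row_op E))) sE (to_ranE (defect (row_op C))).
  split; first exact: val_to_ran.
  exact: corestrK (lift_sigma_mem Ec hEform _ _).
exact: (lift_char_funE Cc Ec hEform gc hB sE ThetaE).
Qed.
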